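(* Let $r\in\mathbb N$, let $0=k_1<k_2<k_3\leq r-2$, $k_4=r$ be integers, and let $M_{k_1},M_{k_2},M_{k_3},M_{k_4}$ be positive numbers (with $M_{k_4}=M_r$). There exists a function $x\in L^{r,r-1}_{\infty,\infty}(\mathbb R_-)$ such that $$\|x^{(k_i)}\|=M_{k_i},\quad i=1,2,3,4,$$ if and only if the following two inequalities hold: $$M_{k_2}\geq \frac{\big((r-k_3)!\big)^{\frac{r-k_2}{r-k_3}}}{(r-k_2)!}\,M_{k_3}^{\frac{r-k_2}{r-k_3}}\,M_r^{\frac{k_2-k_3}{r-k_3}}\qquad (A)$$ and $$M_{k_1}\geq \|\Phi(M_{k_2},M_{k_3},M_r)\|,\qquad (B)$$ where, when (A) holds, $\Phi(M_{k_2},M_{k_3},M_r;t):=\varphi_r(a,b,l;t)$, $t\in\mathbb R_-$, with numbers $l>0$ and $a>b\geq 0$ chosen so that $$\|\varphi_r^{(k_2)}(a,b,l)\|=M_{k_2},\quad \|\varphi_r^{(k_3)}(a,b,l)\|=M_{k_3},\quad \|\varphi_r^{(r)}(a,b,l)\|=M_r.$$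
   Context: $\mathbb R_-=(-\infty,0]$ and $\|\cdot\|$ is the essential supremum norm of $L_\infty(\mathbb R_-)$. $L^r_\infty(\mathbb R_-)$ is the space of functions $x:\mathbb R_-\to\mathbb R$ that have a locally absolutely continuous derivative of order $r-1$ (with $x^{(0)}=x$) and satisfy $x^{(r)}\in L_\infty(\mathbb R_-)$; $L^r_{\infty,\infty}(\mathbb R_-)=L^r_\infty(\mathbb R_-)\cap L_\infty(\mathbb R_-)$. For integers $0\le m\le r$, $L^{r,m}_{\infty,\infty}(\mathbb R_-)$ is the class of functions $x\in L^r_{\infty,\infty}(\mathbb R_-)$ that are non-negative together with all their derivatives up to order $m$ inclusive (almost everywhere for the derivative of order $m$ if $m=r$). For $t\in\mathbb R$, $t_+:=\max\{t,0\}$. For $l>0$ and $a>b\geq0$ let $$\varphi_1(a,b,l;t):=l\big((t+a)_+-2(t+b)_+\big)_+,\quad t\in\mathbb R_-,$$ and for $r\geq2$ let $\varphi_r(a,b,l;t):=\int_{-\infty}^t\varphi_{r-1}(a,b,l;s)\,ds$. The symbol $\varphi_r^{(k)}(a,b,l)$ denotes the $k$-th derivative of $t\mapsto\varphi_r(a,b,l;t)$. If inequality (A) holds, numbers $l>0$, $a>b\ge 0$ satisfying the three equalities in the definition of $\Phi$ exist, so that $\Phi(M_{k_2},M_{k_3},M_r)$ makes sense; any such triple may be used. *)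

(* Defs.v *)
From mathcomp Require Export all_boot all_order all_algebra.
From mathcomp Require Export all_classical all_reals all_analysis.

Set Implicit Arguments.
Unset Strict Implicit.
Unset Printing Implicit Defensive.

Import Order.TTheory GRing.Theory Num.Theory numFieldNormedType.Exports.

Local Open Scope classical_set_scope.
Local Open Scope ring_scope.

(* Functions on the closed half-line are represented by total functions
   R -> R whose values outside Rminus are irrelevant. *)
Definition Rminus {R : realType} : set R := `]-oo, 0]%classic.

(* Differentiation relative to Rminus: the usual derivative at t < 0, and the
   one-sided (left) derivative at the endpoint t = 0. *)
Definition has_deriv {R : realType} (f : R -> R) (t : R) : Prop :=
  cvg ((f s - f t) / (s - t) @[s --> within Rminus t^']).

(* Junk value where the limit does not exist, as for any [lim]. *)
Definition deriv1 {R : realType} (f : R -> R) (t : R) : R :=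
  lim ((f s - f t) / (s - t) @[s --> within Rminus t^']).

Definition derivk {R : realType} (k : nat) (f : R -> R) : R -> R :=
  iter k deriv1 f.

Definition linf_norm {R : realType} (f : R -> R) : \bar R :=
  Lnorm lebesgue_measure +oo%E (EFin \o (f \_ Rminus)).

Definition in_linf {R : realType} (f : R -> R) : Prop :=
  f \_ Rminus \in Lfun lebesgue_measure +oo%E.

Definition abs_continuous_on {R : realType} (a b : R) (f : R -> R) : Prop :=
  forall e : R, 0 < e -> exists2 d : R, 0 < d &
    forall (n : nat) (u v : 'I_n -> R),
      (forall i, [/\ a <= u i, u i <= v i & v i <= b]) ->
      trivIset [set: 'I_n] (fun i => `]u i, v i[%classic) ->
      \sum_(i < n) (v i - u i) < d ->
      \sum_(i < n) `|f (v i) - f (u i)| < e.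

Definition loc_abs_continuous {R : realType} (f : R -> R) : Prop :=
  forall a b : R, a <= b -> b <= 0 -> abs_continuous_on a b f.

(* The space L^r_oo(Rminus), r >= 1.  That the r-th derivative exists almost
   everywhere already follows from local absolute continuity of the
   (r-1)-st one (Lebesgue); it is recorded so that [derivk r x] in the last
   clause is a genuine derivative outside a null set. *)
Definition Lr_inf {R : realType} (r : nat) (x : R -> R) : Prop :=
  [/\ forall k t, (k < r.-1)%N -> Rminus t -> has_deriv (derivk k x) t,
      loc_abs_continuous (derivk r.-1 x),
      {ae lebesgue_measure, forall t : R,
         Rminus t -> has_deriv (derivk r.-1 x) t} &
      in_linf (derivk r x)].

Definition Lr_infinf {R : realType} (r : nat) (x : R -> R) : Prop :=
  Lr_inf r x /\ in_linf x.

(* The class L^{r,m}_{oo,oo}(Rminus), 0 <= m <= r. *)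
Definition Lrm_infinf {R : realType} (r m : nat) (x : R -> R) : Prop :=
  [/\ Lr_infinf r x,
      forall k t, (k <= m)%N -> (k < r)%N -> Rminus t -> 0 <= derivk k x t &
      m = r -> {ae lebesgue_measure, forall t : R,
                  Rminus t -> 0 <= derivk r x t}].

Definition pospart {R : realType} (t : R) : R := Num.max t 0.

(* phi_r for r >= 1; the value at r = 0 is irrelevant. *)
Fixpoint phi {R : realType} (r : nat) (a b l t : R) {struct r} : R :=
  match r with
  | 0 => 0
  | 1 => l * pospart (pospart (t + a) - 2 * pospart (t + b))
  | q.+1 => \int[lebesgue_measure]_(s in `]-oo, t]) phi q a b l s
  end.

Definition Phi_params {R : realType} (r k2 k3 : nat) (M2 M3 Mr : R)
    (p : R * R * R) : Prop :=
  let: (a, b, l) := p in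
  [/\ 0 < l, 0 <= b < a,
      linf_norm (derivk k2 (phi r a b l)) = M2%:E,
      linf_norm (derivk k3 (phi r a b l)) = M3%:E &
      linf_norm (derivk r (phi r a b l)) = Mr%:E].

(* [get] picks some triple (a, b, l) satisfying the three equalities, and is
   meaningless if there is none. *)
Definition Phi {R : realType} (r k2 k3 : nat) (M2 M3 Mr : R) : R -> R :=
  let: (a, b, l) := get (Phi_params r k2 k3 M2 M3 Mr) in phi r a b l.

(* Main.v *)
Require Import Defs.
From mathcomp Require Import measurable_realfun ess_sup_inf ring lra zify.

(** On the half-line, a member x of the class has non-negative, hence
non-decreasing, derivatives of order at most r-2, so their norms are their
values at 0.  Everything is governed by g = x^(r-1), which is non-negative and
Lipschitz with constant M_r, and for k >= 1 the values x^(k)(0) are, up to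
factorials, moments of g; in x(0) the limit of x at -oo is added.  The extremal functions are those for which g is a hat: slope M_r from -a to -b,
slope -M_r afterwards, cut off at 0.  Up to factorials, such a g has moments
a^n - 2 b^n + (2b-a)_+^n, because the hat is the second difference
(t+a)_+ - 2 (t+b)_+ + (t+2b-a)_+ and each truncated power integrates to the
next one; this gives phi_r in closed form (Psi).

Necessity.  Let F_k = x^(k) - phi_r^(k) on [-a, 0].  All the F_k are
non-negative at -a, where phi_r^(k) vanishes.  Since the hat has the largest
possible slope and then the smallest one, F_{r-1} cannot be negative, then
positive, then negative again.  This pattern survives integration from the left
end, and each equality F_k(0) = 0 removes one possible sign change: after the
equality at k_3, F_k cannot become positive once it has been negative; after
the one at k_2, F_k is non-negative.  Hence F_0(0) >= 0, which is (B)
(two_knot_comparison).  With b = 0 the hat is a ramp, F_{r-1} starts with one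
sign change less, and the equality at k_3 alone yields F_{k_2}(0) >= 0, which
is (A) (one_knot_comparison).  The argument uses monotonicity only and involves
neither integrals nor the behaviour at -oo.

That g is Lipschitz is the one measure-theoretic step: g is locally absolutely
continuous with |g'| <= M_r almost everywhere
(abs_continuous_lipschitz).

Sufficiency.  Under (A) a hat with the prescribed moments of orders k_2 and k_3
exists: scaling solves one equation, and the ratio b/a is then found with the
intermediate value theorem between b = 0, where (A) gives the right sign, and
b/a -> 1, where the hat is narrow and far away (hat_ex).  Adding the constant
M_{k_1} - phi_r(0), which is non-negative by (B), to the corresponding phi_r
gives the required x. *)

Set Implicit Arguments.
Unset Strict Implicit.
Unset Printing Implicit Defensive.

Import Order.TTheory GRing.Theory Num.Theory numFieldNormedType.Exports.
Local Open Scope classical_set_scope.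
Local Open Scope ring_scope.

(** * Derivatives relative to the half-line *)

Lemma RminusE {R : realType} (t : R) : Rminus t = (t <= 0) :> Prop.
Proof. by rewrite /Rminus /= in_itv. Qed.

(** The relation behind [has_deriv] and [deriv1]: it carries the value of the
derivative, so that no limit has to be computed with [lim]. *)
Definition rderiv {R : realType} (f : R -> R) (t d : R) : Prop :=
  (f s - f t) / (s - t) @[s --> within Rminus t^'] --> d.

Lemma within_Rminus_left {R : realType} (t : R) (P : set R) : t <= 0 ->
  within Rminus t^' P -> t^'- P.
Proof.
move=> t0 h; have {h} : \forall s \near t, s != t -> Rminus s -> P s by exact: h.
move=> h; have : \forall s \near t, s < t -> P s; last by [].
apply: filterS h => s sP st; apply: sP; first by rewrite lt_eqF.
by rewrite RminusE ltW// (lt_le_trans st).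
Qed.

Lemma within_Rminus_proper {R : realType} (t : R) : t <= 0 ->
  ProperFilter (within Rminus t^').
Proof.
move=> t0; split; last exact: within_filter.
move=> /(within_Rminus_left t0) h0.
have := @filter_not_empty _ _ (at_left_proper_filter t); exact.
Qed.

(** The increment form makes sense at s = t as well and involves no division, so
linearity, locality and continuity are read off from it. *)
Lemma rderivP {R : realType} (f : R -> R) (t d : R) :
  rderiv f t d <->
  forall e, 0 < e -> exists2 h, 0 < h & forall s, s <= 0 -> `|s - t| <= h ->
    `|f s - f t - d * (s - t)| <= e * `|s - t|.
Proof.
rewrite /rderiv; split.
  move=> /cvgrPdist_le fd e e0; have := fd _ e0.
  rewrite near_withinE near_withinE => /nbhs_ballP[h/= h0 hP].
  exists (h / 2); first by rewrite divr_gt0.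
  move=> s s0 sth; have [->|st] := eqVneq s t.
    by rewrite !subrr mulr0 subr0 normr0 mulr0.
  have st0 : 0 < `|s - t| by rewrite normr_gt0 subr_eq0.
  have := hP s; rewrite /ball/= distrC RminusE => /(_ _ st s0) -/(_ _).
  rewrite (le_lt_trans sth)// ?ltr_pdivrMr ?ltr_pMr// ?ltr1n// => /(_ isT).
  rewrite -(ler_pM2r st0) -normrM mulrBl divfK ?subr_eq0//.
  by rewrite distrC.
move=> h; apply/cvgrPdist_le => e e0.
have [x x0 xP] := h _ e0.
rewrite near_withinE near_withinE; apply/nbhs_ballP; exists x => //= s.
rewrite /ball/= distrC => sx st; rewrite RminusE => s0.
have st0 : 0 < `|s - t| by rewrite normr_gt0 subr_eq0.
rewrite -(ler_pM2r st0) -normrM mulrBl divfK ?subr_eq0//.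
by rewrite distrC; apply: xP => //; exact: ltW.
Qed.

Lemma deriv1E {R : realType} (f : R -> R) (t d : R) : t <= 0 ->
  rderiv f t d -> deriv1 f t = d.
Proof.
move=> t0 fd; apply: cvg_lim => //.
exact: within_Rminus_proper.
Qed.

Lemma has_derivP {R : realType} (f : R -> R) (t : R) : t <= 0 ->
  has_deriv f t -> rderiv f t (deriv1 f t).
Proof. by move=> t0; rewrite /has_deriv /rderiv /deriv1. Qed.

Lemma rderiv_has {R : realType} (f : R -> R) (t d : R) :
  rderiv f t d -> has_deriv f t.
Proof. by move=> h; apply/cvg_ex; exists d. Qed.

Lemma eq_rderiv {R : realType} (f g : R -> R) (t d : R) : t <= 0 ->
  {in Rminus, f =1 g} -> rderiv f t d -> rderiv g t d.
Proof.
move=> t0 fg /rderivP h; apply/rderivP => e /h[x x0 xP]; exists x => // s s0 sx.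
by rewrite -!fg ?inE ?RminusE//; exact: xP.
Qed.

Lemma eq_deriv1 {R : realType} (f g : R -> R) :
  {in Rminus, f =1 g} -> {in Rminus, deriv1 f =1 deriv1 g}.
Proof.
move=> fg t; rewrite inE RminusE => t0; rewrite /deriv1.
suff -> : (f s - f t) / (s - t) @[s --> within Rminus t^'] =
          (g s - g t) / (s - t) @[s --> within Rminus t^'] by [].
have fgt : f t = g t by apply: fg; rewrite inE RminusE.
apply/seteqP; split => P h.
  have {}h : \forall s \near t^', Rminus s -> P ((f s - f t) / (s - t)) by exact: h.
  have : \forall s \near t^', Rminus s -> P ((g s - g t) / (s - t)); last by [].
  by apply: filterS h => s sP s0; move: (sP s0); rewrite fgt fg ?inE.
have {}h : \forall s \near t^', Rminus s -> P ((g s - g t) / (s - t)) by exact: h.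
have : \forall s \near t^', Rminus s -> P ((f s - f t) / (s - t)); last by [].
by apply: filterS h => s sP s0; move: (sP s0); rewrite fgt fg ?inE.
Qed.

Lemma rderivB {R : realType} (f g : R -> R) (t d d' : R) :
  rderiv f t d -> rderiv g t d' -> rderiv (fun s => f s - g s) t (d - d').
Proof.
move=> /rderivP fd /rderivP gd; apply/rderivP => e e0.
have e20 : 0 < e / 2 by rewrite divr_gt0.
have [x x0 xP] := fd _ e20; have [y y0 yP] := gd _ e20.
exists (Num.min x y); first by rewrite lt_min x0.
move=> s s0; rewrite le_min => /andP[sx sy].
rewrite [X in `|X|](_ : _ =
  (f s - f t - d * (s - t)) - (g s - g t - d' * (s - t))); last by ring.
rewrite (le_trans (ler_normB _ _))//.
have := xP s s0 sx; have := yP s s0 sy; lra.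
Qed.

Lemma is_derive_rderiv {R : realType} (f : R -> R) (t d : R) :
  is_derive t 1 f d -> rderiv f t d.
Proof.
move=> [fd <-]; move/cvg_ex: (fd) => [l fl]; rewrite /derive (cvg_lim _ fl)//.
apply/rderivP => e e0; move/cvgrPdist_le: fl => /(_ _ e0).
rewrite near_withinE => /nbhs_ballP[h/= h0 hP]; exists (h / 2).
  by rewrite divr_gt0.
move=> s s0 sth; have [->|st] := eqVneq s t.
  by rewrite !subrr mulr0 subr0 normr0 mulr0.
have st0 : 0 < `|s - t| by rewrite normr_gt0 subr_eq0.
have := hP (s - t); rewrite /ball/= sub0r normrN subr_eq0.
rewrite (le_lt_trans sth) ?ltr_pdivrMr ?ltr_pMr// ?ltr1n// => /(_ isT st).
rewrite -(ler_pM2r st0) -normrM mulrBl.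
rewrite /GRing.scale /= mulr1 subrK mulrAC mulVf ?mul1r ?subr_eq0//.
by rewrite distrC.
Qed.

Lemma rderiv_is_derive {R : realType} (f : R -> R) (t d : R) : t < 0 ->
  rderiv f t d -> is_derive t 1 f d.
Proof.
move=> t0 /rderivP h.
have fl : h^-1 *: (f (h *: 1 + t) - f t) @[h --> 0^'] --> d.
  apply/cvgrPdist_le => e e0; have [x x0 xP] := h _ e0.
  rewrite near_withinE; apply/nbhs_ballP; exists (Num.min x (- t)).
    by rewrite /= lt_min x0 oppr_gt0.
  move=> s; rewrite /ball/= sub0r normrN lt_min => /andP[sx sNt] sn0.
  have sP : 0 < `|s| by rewrite normr_gt0.
  rewrite -(ler_pM2r sP) -normrM mulrBl /GRing.scale/= mulr1.
  rewrite mulrAC mulVf// mul1r distrC.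
  have := xP (s + t); rewrite addrK; apply; last exact: ltW.
  by rewrite -lerBrDr sub0r; apply: ltW; apply: le_lt_trans sNt; exact: ler_norm.
have dd : derivable f t 1 by apply/cvg_ex; exists d.
by split => //; rewrite /derive (cvg_lim _ fl).
Qed.

Lemma rderiv_within_continuous {R : realType} (f : R -> R) (t d : R) :
  rderiv f t d -> f s @[s --> within Rminus (nbhs t)] --> f t.
Proof.
move=> /rderivP /(_ _ ltr01)[h h0 hP]; apply/cvgrPdist_le => e e0.
have k0 : 0 < 1 + `|d| by rewrite ltr_pwDl.
rewrite near_withinE; apply/nbhs_ballP.
exists (Num.min h (e / (1 + `|d|))).
  by rewrite /= lt_min h0 divr_gt0.
move=> s; rewrite /ball/= distrC lt_min => /andP[sh se]; rewrite RminusE => s0.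
have H := hP _ s0 (ltW sh).
rewrite distrC (_ : f s - f t = (f s - f t - d * (s - t)) + d * (s - t)); last by ring.
rewrite (le_trans (ler_normD _ _))// normrM.
move: se; rewrite ltr_pdivlMr//; move: H; nra.
Qed.

(** At the end point 0 only continuity from the left is available, which is all
the mean value theorem asks for. *)
Lemma rderiv_ge0_homo {R : realType} (f f' : R -> R) (p q : R) : q <= 0 ->
  (forall t, p <= t <= q -> rderiv f t (f' t)) ->
  (forall t, p < t < q -> 0 <= f' t) -> p <= q -> f p <= f q.
Proof.
move=> q0 fd f0 pq.
have fi t : p < t < q -> is_derive t 1 f (f' t).
  move=> /andP[pt tq]; apply: rderiv_is_derive; first exact: lt_le_trans q0.
  by apply: fd; rewrite !ltW.
apply: (@ger0_derive1_le_cc _ f p q); rewrite ?in_itv/= ?lexx ?pq//.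
- by move=> t; rewrite in_itv/= => /fi[].
- by move=> t; rewrite in_itv/= derive1E => tpq; have [_ ->] := fi _ tpq; exact: f0.
- apply/subspace_continuousP => t; rewrite /= in_itv/= => tpq.
  have := rderiv_within_continuous (fd _ tpq).
  apply: cvg_trans; apply: cvg_app; apply: within_subset => s /=.
  by rewrite in_itv/= RminusE => /andP[_ /le_trans]; apply.
Qed.

(** * Null sets and the essential supremum norm *)

Lemma ae_lebesgueS {R : realType} (P Q : R -> Prop) : (forall t, P t -> Q t) ->
  {ae lebesgue_measure, forall t : R, P t} ->
  {ae lebesgue_measure, forall t : R, Q t}.
Proof.
move=> PQ [N [mN N0 PN]]; exists N; split => //.
by apply: subset_trans PN => t /= nQ /PQ.
Qed.

Lemma ae_lebesgueI {R : realType} (P Q : R -> Prop) :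
  {ae lebesgue_measure, forall t : R, P t} ->
  {ae lebesgue_measure, forall t : R, Q t} ->
  {ae lebesgue_measure, forall t : R, P t /\ Q t}.
Proof.
move=> [N [mN N0 PN]] [M [mM M0 QM]]; exists (N `|` M).
split; [exact: measurableU|by rewrite measureU0|].
move=> t /= nPQ; have [Pt|nPt] := pselect (P t); last by left; exact: PN.
by right; apply: QM => /= Qt; exact: nPQ.
Qed.

Lemma ae_lebesgue_notin {R : realType} (s : seq R) :
  {ae lebesgue_measure, forall t : R, t \notin s}.
Proof.
have cs : countable ([set` s] : set R) by exact/finite_set_countable/finite_seq.
exists [set` s]; split.
- by apply: countable_measurable cs => t; exact: measurable_set1.
- exact: countable_lebesgue_measure0.
- by move=> t /=; rewrite /= => /negP; rewrite negbK.
Qed.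

(** An interval of positive length is not contained in a null set. *)
Lemma ae_itv_ex {R : realType} (P : R -> Prop) (p q : R) : p < q ->
  {ae lebesgue_measure, forall t : R, P t} -> exists2 t, p < t < q & P t.
Proof.
move=> pq [N [mN N0 PN]]; apply: contrapT => hn.
have sub : `]p, q[%classic `<=` N.
  move=> t /=; rewrite in_itv/= => tpq; apply: PN => /= Pt; apply: hn.
  by exists t.
have : (lebesgue_measure `]p, q[%classic <= lebesgue_measure N)%E.
  by apply: le_measure; rewrite ?inE.
rewrite [X in (_ <= X)%E]N0 lebesgue_measure_itv/= lte_fin pq -EFinD lee_fin.
by rewrite subr_le0 leNgt pq.
Qed.

Lemma linf_normE {R : realType} (f : R -> R) :
  linf_norm f = ess_sup lebesgue_measure (fun t => `|(f \_ Rminus) t|%:E).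
Proof.
rewrite /linf_norm unlock /Lnorm.
have muT : (0 < lebesgue_measure [set: R])%E.
  by rewrite -set_itvNyy lebesgue_measure_itv/= ltry.
by rewrite ifT.
Qed.

Lemma linf_norm_leP {R : realType} (f : R -> R) (c : R) : 0 <= c ->
  (linf_norm f <= c%:E)%E <->
  {ae lebesgue_measure, forall t : R, Rminus t -> `|f t| <= c}.
Proof.
move=> c0; rewrite linf_normE; split.
  move/ess_supP; apply: ae_lebesgueS => t; rewrite lee_fin => h t0.
  by move: h; rewrite patchE mem_set.
move=> h; suff : {ae lebesgue_measure, forall t : R,
    (`|(f \_ Rminus) t|%:E <= c%:E)%E} by move=> ?; exact/ess_supP.
apply: ae_lebesgueS h => t h; rewrite lee_fin patchE.
case: ifPn => [|_]; last by rewrite normr0.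
by rewrite inE; exact: h.
Qed.

Lemma eq_linf_norm {R : realType} (f g : R -> R) :
  {in Rminus, f =1 g} -> linf_norm f = linf_norm g.
Proof.
move=> fg; rewrite /linf_norm; congr (Lnorm _ _ (EFin \o _)).
by apply/funext => t; rewrite !patchE; case: ifPn => // /fg.
Qed.

Lemma linf_norm_ge {R : realType} (f : R -> R) (c p q : R) :
  p < q -> q <= 0 -> (forall t, p < t < q -> c <= `|f t|) ->
  (c%:E <= linf_norm f)%E.
Proof.
move=> pq q0 fc; rewrite linf_normE.
have [t /andP[pt tq] ] := ae_itv_ex pq
  (ess_sup_ge lebesgue_measure (fun t => `|(f \_ Rminus) t|%:E)).
apply: le_trans; rewrite lee_fin patchE mem_set ?fc ?pt//.
by rewrite RminusE (ltW (lt_le_trans tq q0)).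
Qed.

(** The supremum of a non-decreasing non-negative function is its value at 0, and
left continuity there (here, from a derivative) makes it essential: the values
close to it are taken on an interval of positive length. *)
Lemma linf_norm_homo {R : realType} (f : R -> R) (d : R) :
  (forall s t, s <= t -> t <= 0 -> f s <= f t) ->
  (forall t, t <= 0 -> 0 <= f t) -> rderiv f 0 d ->
  linf_norm f = (f 0)%:E.
Proof.
move=> fh f0 fd; apply/eqP; rewrite eq_le; apply/andP; split.
  apply/linf_norm_leP; first exact: f0.
  apply: aeW => t; rewrite RminusE => t0.
  by rewrite ger0_norm ?f0// fh.
apply/lee_addgt0Pr => e e0.
have /cvgrPdist_le /(_ _ e0) := rderiv_within_continuous fd.
rewrite near_withinE => /nbhs_ballP[h/= h0 hP].
have : ((f 0 - e)%:E <= linf_norm f)%E.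
  apply: (@linf_norm_ge _ _ _ (- h) 0); rewrite ?oppr_lt0// => t /andP[ht t0].
  have := hP t; rewrite /ball/= sub0r normrN ltr0_norm// RminusE.
  rewrite ltrNl => /(_ ht (ltW t0)).
  rewrite !ger0_norm ?f0 ?(ltW t0)//; first lra.
  by rewrite subr_ge0 fh// ltW.
by rewrite EFinB leeBlDr.
Qed.

(** * Local absolute continuity and a bounded derivative give a Lipschitz function *)

(** Up to t, the function g grows at rate at most K, apart from its increments over
finitely many consecutive intervals lying in U.  In the application U is an open
set of small measure around the points without a good derivative, and absolute
continuity bounds the exceptional increments. *)
Definition increment_controlled {R : realType} (g : R -> R) (K a : R)
    (U : set R) (t : R) : Prop :=
  exists n (u v : nat -> R),
  [/\ forall i, (i < n)%N -> [/\ a <= u i, u i <= v i, v i <= t &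
        `]u i, v i[ `<=` U],
      forall i j, (i < j)%N -> (j < n)%N -> v i <= u j &
      `|g t - g a| <= K * (t - a) + \sum_(i < n) `|g (v i) - g (u i)|].

Lemma increment_controlled_refl {R : realType} (g : R -> R) (K a : R) (U : set R) :
  increment_controlled g K a U a.
Proof.
exists 0%N, (fun=> 0), (fun=> 0); split => //.
by rewrite !subrr mulr0 big_ord0 normr0 addr0.
Qed.

Lemma increment_controlled_lipschitz {R : realType} (g : R -> R) (K a : R)
    (U : set R) (s t : R) :
  s <= t -> `|g t - g s| <= K * (t - s) ->
  increment_controlled g K a U s -> increment_controlled g K a U t.
Proof.
move=> st gst [n [u [v [h1 h2 h3]]]]; exists n, u, v; split => //.
  by move=> i /h1[? ? vs ?]; split => //; exact: le_trans st.
rewrite (_ : g t - g a = (g t - g s) + (g s - g a)); last by ring.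
rewrite (le_trans (ler_normD _ _))// (le_trans (lerD gst h3))//.
by rewrite addrA lerD2r -mulrDr (_ : t - s + (s - a) = t - a)//; ring.
Qed.

Lemma increment_controlled_open {R : realType} (g : R -> R) (K a : R)
    (U : set R) (s t : R) :
  0 <= K -> a <= s -> s <= t -> `]s, t[ `<=` U ->
  increment_controlled g K a U s -> increment_controlled g K a U t.
Proof.
move=> K0 as_ st stU [n [u [v [h1 h2 h3]]]].
exists n.+1, (fun i => if i == n then s else u i), (fun i => if i == n then t else v i).
split.
- move=> i; rewrite ltnS leq_eqVlt; case: eqP => //= _ /h1[? ? vs ?]; split => //.
  exact: le_trans st.
- move=> i j ij; rewrite ltnS leq_eqVlt; case: eqP ij => /= [-> ilt _|jn ij jlt].
    by rewrite (ltn_eqF ilt); have [] := h1 _ ilt.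
  by rewrite (ltn_eqF (ltn_trans ij jlt)); exact: h2.
- rewrite big_ord_recr/= eqxx addrA.
  rewrite (_ : g t - g a = (g s - g a) + (g t - g s)); last by ring.
  rewrite (le_trans (ler_normD _ _))// lerD2r (le_trans h3)//.
  apply: lerD; first by rewrite ler_wpM2l// lerB.
  apply: ler_sum => i _; by rewrite (ltn_eqF (ltn_ord i)).
Qed.

(** The supremum of the points that can be reached is itself reached and passed,
since near each point of [a, b] one of the two extension steps applies. *)
Lemma increment_controlled_end {R : realType} (g : R -> R) (K a b : R) (U : set R) :
  a <= b -> 0 <= K -> open U ->
  (forall c, a <= c <= b -> U c \/
     exists2 h, 0 < h & forall s, a <= s <= b -> `|s - c| <= h ->
       `|g s - g c| <= K * `|s - c|) ->
  increment_controlled g K a U b.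
Proof.
move=> ab K0 oU hc.
pose S := [set t | a <= t <= b /\ increment_controlled g K a U t].
have Sa : S a by split; [rewrite lexx|exact: increment_controlled_refl].
have hS : has_sup S.
  by split; [exists a|exists b => t [/andP[]]].
have [c cS adh] : exists2 c, (forall t, S t -> t <= c) &
    (forall h, 0 < h -> exists2 s, S s & c - h < s).
  exists (sup S); first by move=> t; exact: ub_le_sup hS.2 _.
  by move=> h h0; exact: sup_adherent.
have ac : a <= c by exact: cS.
have cb : c <= b by apply/ler_addgt0Pr => h /adh[s [/andP[_ sb] _]]; lra.
suff [h h0 hP] : exists2 h, 0 < h & forall s t, a <= s -> s <= c -> c <= t ->
    t <= b -> c - s <= h -> t - c <= h ->
    increment_controlled g K a U s -> increment_controlled g K a U t.
  (* From a reachable s within h of the supremum c, any t within h to the right of c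
     is reachable; so c would not be an upper bound unless it is b. *)
  have [s [/andP[as_ sb] Ps] hs] := adh _ h0.
  have sc : s <= c by apply: cS; split => //; rewrite as_.
  have [cbh|cbh] := leP b (c + h).
    by apply: (hP s b) => //; lra.
  have Pt : increment_controlled g K a U (c + h) by apply: (hP s (c + h)) => //; lra.
  suff : c + h <= c by lra.
  by apply: cS; split => //; lra.
case: (hc c); first by rewrite ac cb.
- move=> Uc; have /nbhs_ballP[h/= h0 hP] := open_nbhs_nbhs (conj oU Uc).
  exists (h / 2); first by rewrite divr_gt0.
  move=> s t as_ sc ct tb csh tch; apply: increment_controlled_open => //.
    exact: le_trans ct.
  move=> y /=; rewrite in_itv/= => /andP[sy yt]; apply: hP; rewrite /ball/=.
  rewrite ltr_norml; apply/andP; split; lra.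
- move=> [h h0 hP]; exists h => // s t as_ sc ct tb csh tch.
  apply: increment_controlled_lipschitz; first exact: le_trans ct.
  have := hP s; have := hP t; rewrite (distrC s c) (ger0_norm (_ : 0 <= t - c)) ?subr_ge0//.
  rewrite (ger0_norm (_ : 0 <= c - s)) ?subr_ge0//.
  rewrite (distrC (g s) (g c)).
  rewrite (le_trans ac ct) tb as_ (le_trans sc cb) => /(_ isT tch) H1 /(_ isT csh) H2.
  rewrite (_ : g t - g s = (g t - g c) + (g c - g s)); last by ring.
  by rewrite (le_trans (ler_normD _ _))//; lra.
Qed.

Lemma sum_disjoint_itv_le {R : realType} (n : nat) (u v : nat -> R) (U : set R) :
  measurable U ->
  (forall i, (i < n)%N -> u i <= v i /\ `]u i, v i[ `<=` U) ->
  (forall i j, (i < j)%N -> (j < n)%N -> v i <= u j) ->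
  ((\sum_(i < n) (v i - u i))%:E <= lebesgue_measure U)%E.
Proof.
move=> mU uvU uv.
have -> : (\sum_(i < n) (v i - u i))%:E =
    (\sum_(i < n) lebesgue_measure `]u i, v i[%classic)%E.
  rewrite -sumEFin; apply: eq_bigr => i _; rewrite lebesgue_measure_itv/= lte_fin.
  have [uvi _] := uvU _ (ltn_ord i).
  by move: uvi; rewrite le_eqVlt => /predU1P[->|->//]; rewrite ltxx subrr.
have mI (i : 'I_n) : measurable (`]u i, v i[%classic : set R) by exact: measurable_itv.
rewrite -(@measure_semi_additive_ord _ _ _ lebesgue_measure n
  (fun i => `]u i, v i[%classic))//.
- apply: le_measure; rewrite ?inE//; first exact: bigsetU_measurable.
  rewrite -(bigcup_mkord n (fun i => `]u i, v i[%classic)) => y [i /= /uvU[_]].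
  by apply.
- move=> i j _ _ [y [/=]]; rewrite !in_itv/= => /andP[uy yv] /andP[uy' yv'].
  apply: val_inj; have [ij|ij|//] := ltngtP i j.
    by have := lt_le_trans (lt_trans uy' yv) (uv _ _ ij (ltn_ord j)); rewrite ltxx.
  by have := lt_le_trans (lt_trans uy yv') (uv _ _ ij (ltn_ord i)); rewrite ltxx.
- exact: bigsetU_measurable.
Qed.

(** The points where the derivative is missing or too large form a null set, which
is covered by an open set of measure less than the modulus d given by absolute
continuity for e.  Outside of it g moves at speed at most K + e, and inside it
by at most e altogether. *)
Lemma abs_continuous_lipschitz {R : realType} (g : R -> R) (K a b : R) :
  a <= b -> b <= 0 -> 0 <= K -> abs_continuous_on a b g ->
  {ae lebesgue_measure, forall t : R, Rminus t ->
     exists2 d, `|d| <= K & rderiv g t d} ->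
  `|g b - g a| <= K * (b - a).
Proof.
move=> ab b0 K0 acg [N [mN N0 NP]].
suff H e : 0 < e -> `|g b - g a| <= (K + e) * (b - a) + e.
  (* The two errors (b - a) e' and e' add up to e for e' = e / (b - a + 1). *)
  have k0 : 0 < b - a + 1 by lra.
  apply/ler_addgt0Pr => e e0.
  have := H _ (divr_gt0 e0 k0); rewrite mulrDl -addrA -{2}(mulr1 (e / _)) -mulrDr.
  by rewrite divfK ?gt_eqF.
move=> e0; have [d d0 dP] := acg _ e0.
have [|U [oU NU mUN]] := lebesgue_regularity_outer mN _ d0.
  by rewrite [X in (X < _)%E]N0 ltry.
have mU : measurable U by exact: open_measurable.
have Ud : (lebesgue_measure U < d%:E)%E.
  apply: le_lt_trans mUN.
  rewrite -[X in (_ <= X)%E](measureU0 _ mN N0); last exact: measurableD.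
  by rewrite setDKU.
have : increment_controlled g (K + e) a U b.
  apply: increment_controlled_end => //; first by lra.
  move=> c /andP[ac cb]; have [Nc|Nc] := pselect (N c); first by left; exact: NU.
  right; have [l lK /rderivP gl] : exists2 d, `|d| <= K & rderiv g c d.
    apply: contrapT => nd; apply: Nc; apply: NP => /= h; apply: nd; apply: h.
    by rewrite RminusE (le_trans cb).
  have [h h0 hP] := gl _ e0; exists h => // s /andP[_ sb] sch.
  rewrite (_ : g s - g c = (g s - g c - l * (s - c)) + l * (s - c)); last by ring.
  rewrite (le_trans (ler_normD _ _))// addrC mulrDl lerD//; last first.
    by apply: hP => //; exact: le_trans b0.
  by rewrite normrM ler_wpM2r.
move=> [n [u [v [h1 h2 h3]]]]; rewrite (le_trans h3)// lerD2l.
apply: ltW; apply: (dP n (fun i => u i) (fun i => v i)).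
- by move=> i; have [] := h1 _ (ltn_ord i).
- move=> i j _ _ [y [/=]]; rewrite !in_itv/= => /andP[uy yv] /andP[uy' yv'].
  apply: val_inj; have [ij|ij|//] := ltngtP i j.
    by have := lt_le_trans (lt_trans uy' yv) (h2 _ _ ij (ltn_ord j)); rewrite ltxx.
  by have := lt_le_trans (lt_trans uy yv') (h2 _ _ ij (ltn_ord i)); rewrite ltxx.
- rewrite -lte_fin; apply: le_lt_trans Ud.
  by apply: sum_disjoint_itv_le => // i /h1[].
Qed.

(** * Sign patterns under integration *)

Lemma rderivN {R : realType} (f : R -> R) (t d : R) :
  rderiv f t d -> rderiv (fun s => - f s) t (- d).
Proof.
move=> /rderivP h; apply/rderivP => e /h[x x0 xP]; exists x => // s s0 sx.
rewrite (_ : - f s - - f t - - d * (s - t) = - (f s - f t - d * (s - t))); last by ring.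
by rewrite normrN; exact: xP.
Qed.

Lemma rderiv_decr {R : realType} (f f' : R -> R) (p q : R) : q <= 0 ->
  (forall t, p <= t <= q -> rderiv f t (f' t)) -> p <= q -> f q < f p ->
  exists2 x, p < x < q & f' x < 0.
Proof.
move=> q0 fd pq; rewrite ltNge => /negP fqp; apply: contrapT => hn; apply: fqp.
apply: rderiv_ge0_homo q0 fd _ pq => t tpq; rewrite leNgt; apply/negP => ft.
by apply: hn; exists t.
Qed.

Lemma rderiv_incr {R : realType} (f f' : R -> R) (p q : R) : q <= 0 ->
  (forall t, p <= t <= q -> rderiv f t (f' t)) -> p <= q -> f p < f q ->
  exists2 x, p < x < q & 0 < f' x.
Proof.
move=> q0 fd pq fpq.
have [||x xpq] := @rderiv_decr R (fun s => - f s) (fun s => - f' s) p q q0 _ pq.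
- by move=> t /fd/rderivN.
- by rewrite ltrN2.
- by rewrite oppr_lt0 => ?; exists x.
Qed.

Section sign_patterns.
Context {R : realType}.
Variables (A : R) .

(** Stated with a weak inequality in the conclusion, because the equality f 0 = 0
used below puts a zero after negative values. *)
Definition no_pos_between_neg (f : R -> R) : Prop := forall s t u,
  A <= s -> s <= t -> t <= u -> u <= 0 -> f s < 0 -> f u < 0 -> f t <= 0.

Definition no_pos_after_neg (f : R -> R) : Prop := forall s t,
  A <= s -> s <= t -> t <= 0 -> f s < 0 -> f t <= 0.

Variables (f f' : R -> R).
Hypothesis fd : forall t, A <= t <= 0 -> rderiv f t (f' t).
Hypothesis fA : 0 <= f A.

Let decr p q : A <= p -> p <= q -> q <= 0 -> f q < f p ->
  exists2 x, p < x < q & f' x < 0.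
Proof.
move=> Ap pq q0; apply: rderiv_decr => // t /andP[pt tq].
by apply: fd; rewrite (le_trans Ap)// (le_trans tq).
Qed.

Let incr p q : A <= p -> p <= q -> q <= 0 -> f p < f q ->
  exists2 x, p < x < q & 0 < f' x.
Proof.
move=> Ap pq q0; apply: rderiv_incr => // t /andP[pt tq].
by apply: fd; rewrite (le_trans Ap)// (le_trans tq).
Qed.

(** If f were negative, positive, negative, then, starting from f A >= 0, it would
decrease, increase and decrease, so f' would take a positive value between two
negative ones. *)
Lemma no_pos_between_neg_prim : no_pos_between_neg f' -> no_pos_between_neg f.
Proof.
move=> f'P s t u As st tu u0 fs fu; rewrite leNgt; apply/negP => ft.
have [||||x1 /andP[Ax1 x1s] fx1] := @decr A s; rewrite ?lexx//; try by have := fA; lra.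
have [||||x2 /andP[sx2 x2t] fx2] := @incr s t; rewrite ?lexx//; try by have := fA; lra.
have [||||x3 /andP[tx3 x3u] fx3] := @decr t u; rewrite ?lexx//; try by have := fA; lra.
have : f' x2 <= 0 by apply: (f'P x1 x2 x3); lra.
lra.
Qed.

(** A prescribed zero at the right end acts as the last negative value: a positive
value of f would have to be followed by a decrease. *)
Lemma no_pos_between_neg_prim_eq0 : no_pos_between_neg f' -> f 0 = 0 ->
  no_pos_after_neg f.
Proof.
move=> f'P f0 s t As st t0 fs; rewrite leNgt; apply/negP => ft.
have [||||x1 /andP[Ax1 x1s] fx1] := @decr A s; rewrite ?lexx//; try by have := fA; lra.
have [||||x2 /andP[sx2 x2t] fx2] := @incr s t; rewrite ?lexx//; try by have := fA; lra.
have [||||x3 /andP[tx3 x3u] fx3] := @decr t 0; rewrite ?lexx ?f0//; try by have := fA; lra.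
have : f' x2 <= 0 by apply: (f'P x1 x2 x3); lra.
lra.
Qed.

Lemma no_pos_after_neg_prim : no_pos_after_neg f' -> no_pos_after_neg f.
Proof.
move=> f'P s t As st t0 fs; rewrite leNgt; apply/negP => ft.
have [||||x1 /andP[Ax1 x1s] fx1] := @decr A s; rewrite ?lexx//; try by have := fA; lra.
have [||||x2 /andP[sx2 x2t] fx2] := @incr s t; rewrite ?lexx//; try by have := fA; lra.
have : f' x2 <= 0 by apply: (f'P x1 x2); lra.
lra.
Qed.

(** A negative value of f would be reached by a decrease and left by an increase up
to f 0 = 0. *)
Lemma no_pos_after_neg_prim_eq0 : no_pos_after_neg f' -> f 0 = 0 ->
  forall t, A <= t <= 0 -> 0 <= f t.
Proof.
move=> f'P f0 s /andP[As s0]; rewrite leNgt; apply/negP => fs.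
have [||||x1 /andP[Ax1 x1s] fx1] := @decr A s; rewrite ?lexx//; try by have := fA; lra.
have [||||x2 /andP[sx2 x2t] fx2] := @incr s 0; rewrite ?lexx ?f0//; try by have := fA; lra.
have : f' x2 <= 0 by apply: (f'P x1 x2); lra.
lra.
Qed.

Lemma ge0_prim : (forall t, A <= t <= 0 -> 0 <= f' t) ->
  forall t, A <= t <= 0 -> 0 <= f t.
Proof.
move=> f'0 s /andP[As s0]; rewrite leNgt; apply/negP => fs.
have [||||x1 /andP[Ax1 x1s] fx1] := @decr A s; rewrite ?lexx//; try by have := fA; lra.
have : 0 <= f' x1 by apply: f'0; lra.
lra.
Qed.

End sign_patterns.

Lemma down_ind (P : nat -> Prop) (k m : nat) : (k <= m)%N -> P m ->
  (forall j, (k <= j < m)%N -> P j.+1 -> P j) -> P k.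
Proof.
move=> km Pm h; suff H i : (i <= m - k)%N -> P (m - i)%N.
  by rewrite -(subKn km); exact: H.
elim: i => [|i IH] ik; first by rewrite subn0.
apply: h; first by lia.
by rewrite (_ : (m - i.+1).+1 = m - i)%N; [apply: IH|]; lia.
Qed.

Section comparison.
Context {R : realType}.
Variables (A : R) (F : nat -> R -> R) (m : nat).
Hypothesis A0 : A <= 0.
Hypothesis Fd : forall k t, (k < m)%N -> A <= t <= 0 -> rderiv (F k) t (F k.+1 t).
Hypothesis FA : forall k, (k < m)%N -> 0 <= F k A.

(** F is a chain of successive derivatives.  Starting from at most one sign change in
F m, the zero of F k3 at 0 leaves none, so from k3 downwards everything is
non-negative. *)
Lemma one_knot_comparison (k2 k3 : nat) : (k2 < k3)%N -> (k3 < m)%N ->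
  no_pos_after_neg A (F m) ->
  F k3 0 = 0 -> forall t, A <= t <= 0 -> 0 <= F k2 t.
Proof.
move=> k23 k3m Fm F30.
have F3 : forall t, A <= t <= 0 -> 0 <= F k3 t.
  apply: no_pos_after_neg_prim_eq0 F30; [by move=> t; exact: Fd|exact: FA|].
  apply: (@down_ind (fun k => no_pos_after_neg A (F k)) _ m) => // j /andP[jk jm].
  by apply: no_pos_after_neg_prim; [move=> t; exact: Fd|exact: FA].
apply: (@down_ind (fun k => forall t, A <= t <= 0 -> 0 <= F k t) _ k3) => //.
  exact: ltnW.
move=> j /andP[jk jm]; have jm' := ltn_trans jm k3m.
by apply: ge0_prim; [move=> t; exact: Fd|exact: FA].
Qed.

(** As in the previous comparison, with one more sign change at the top and one more
zero at 0 to remove it. *)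
Lemma two_knot_comparison (k2 k3 : nat) : (0 < k2)%N -> (k2 < k3)%N -> (k3 < m)%N ->
  no_pos_between_neg A (F m) -> F k3 0 = 0 -> F k2 0 = 0 -> 0 <= F 0 0.
Proof.
move=> k20 k23 k3m Fm F30 F20.
have F3 : no_pos_after_neg A (F k3).
  apply: no_pos_between_neg_prim_eq0 F30; [by move=> t; exact: Fd|exact: FA|].
  apply: (@down_ind (fun k => no_pos_between_neg A (F k)) _ m) => // j /andP[jk jm].
  by apply: no_pos_between_neg_prim; [move=> t; exact: Fd|exact: FA].
have k2m := ltn_trans k23 k3m.
have F2 : forall t, A <= t <= 0 -> 0 <= F k2 t.
  apply: no_pos_after_neg_prim_eq0 F20; [by move=> t; exact: Fd|exact: FA|].
  apply: (@down_ind (fun k => no_pos_after_neg A (F k)) _ k3) => // j /andP[jk jm].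
  have jm' := ltn_trans jm k3m.
  by apply: no_pos_after_neg_prim; [move=> t; exact: Fd|exact: FA].
apply: (@down_ind (fun k => forall t, A <= t <= 0 -> 0 <= F k t) 0 k2) => //.
  move=> j /andP[jk jm]; have jm' := ltn_trans jm k2m.
  by apply: ge0_prim; [move=> t; exact: Fd|exact: FA].
by rewrite A0 lexx.
Qed.

End comparison.

(** * Closed form of the extremal functions *)

Lemma pospart_ge0E {R : realType} (t : R) : 0 <= t -> pospart t = t.
Proof. by move=> t0; rewrite /pospart; apply/max_idPl. Qed.

Lemma pospart_le0E {R : realType} (t : R) : t <= 0 -> pospart t = 0.
Proof. by move=> t0; rewrite /pospart; apply/max_idPr. Qed.

Lemma pospartM {R : realType} (c t : R) : 0 <= c -> pospart (c * t) = c * pospart t.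
Proof. by move=> c0; rewrite /pospart maxr_pMr// mulr0. Qed.

Lemma pospart_cases {R : realType} (t : R) :
  (t <= 0 /\ pospart t = 0) \/ (0 <= t /\ pospart t = t).
Proof.
have [t0|t0] := leP t 0; first by left; rewrite pospart_le0E.
by right; rewrite pospart_ge0E// ltW.
Qed.

(** Derivative of (t + c)_+ away from its kink. *)
Definition step {R : realType} (c t : R) : R := (- c < t)%R%:R.

Lemma is_derive_pospart1 {R : realType} (c t : R) : t != - c ->
  is_derive t 1 (fun s => pospart (s + c)) (step c t).
Proof.
rewrite /step; case: ltgtP => // tc _.
- apply: (@near_eq_is_derive _ _ _ (fun s => s + c)).
    near=> s; rewrite pospart_ge0E// -lerBlDr sub0r ltW//; near: s.
    exact: lt_nbhsr.
  by apply: is_derive_eq; rewrite addr0.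
- apply: (@near_eq_is_derive _ _ _ (cst 0)).
  near=> s; rewrite pospart_le0E// -lerBrDr sub0r ltW//; near: s.
  exact: lt_nbhsl.
Unshelve. all: by end_near. Qed.

(** Powers at least 2 of the truncated linear function are differentiable at the
kink too, with derivative 0. *)
Lemma is_derive_pospart {R : realType} (n : nat) (c t : R) :
  is_derive t 1 (fun s => pospart (s + c) ^+ n.+2) (n.+2%:R * pospart (t + c) ^+ n.+1).
Proof.
have [tc|tc] := eqVneq t (- c); last first.
  have := is_deriveX n.+2 (is_derive_pospart1 tc).
  rewrite (_ : _ ^+ _ = fun s => pospart (s + c) ^+ n.+2); last first.
    by apply/funext => s; rewrite exprfctE.
  move=> h; apply: is_derive_eq h _.
  rewrite /GRing.scale/= /step; case: ltgtP tc => //= ct _; rewrite ?mulr1//.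
  by rewrite pospart_le0E ?expr0n/= ?mulr0// -lerBrDr sub0r ltW.
have E : pospart (t + c) = 0 by rewrite tc addNr pospart_le0E.
rewrite E expr0n/= mulr0.
have fl : h^-1 *: (pospart (h *: 1 + t + c) ^+ n.+2 - pospart (t + c) ^+ n.+2)
    @[h --> 0^'] --> (0 : R).
  apply/cvgrPdist_le => e e0; rewrite near_withinE; apply/nbhs_ballP.
  (* For |s| < min 1 e the quotient is at most |s|^(n+1) <= |s|. *)
  exists (Num.min 1 e); first by rewrite /= lt_min ltr01.
  move=> s; rewrite /ball/= !sub0r !normrN lt_min => /andP[s1 se] sn0.
  rewrite E expr0n/= subr0 -addrA {1}tc addNr addr0 /GRing.scale/= mulr1.
  rewrite exprS mulrA normrM normrM normrX.
  have ps : `|pospart s| <= `|s|.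
    by case: (pospart_cases s) => -[_ ->]; rewrite ?normr0.
  have s0 : 0 < `|s| by rewrite normr_gt0.
  have h1 : `|s^-1| * `|pospart s| <= 1.
    by rewrite normfV mulrC ler_pdivrMr// mul1r.
  have h2 : `|pospart s| ^+ n.+1 <= e.
    rewrite exprS (le_trans _ (ltW se))// -[leRHS]mulr1; apply: ler_pM => //.
    by rewrite exprn_ile1// (le_trans ps)// ltW.
  by rewrite -[leRHS]mul1r; apply: ler_pM => //; rewrite ?mulr_ge0 ?exprn_ge0.
have dd : derivable (fun s => pospart (s + c) ^+ n.+2) t 1 by apply/cvg_ex; exists 0.
by split => //; rewrite /derive; exact: (cvg_lim _ fl).
Qed.

(** The closed form of [phi q], valid on the whole line: the hat is a second
difference of truncated linear functions, and truncated powers integrate to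
truncated powers. *)
Definition Psi {R : realType} (q : nat) (a b l t : R) : R :=
  l / q`!%:R * (pospart (t + a) ^+ q - 2 * pospart (t + b) ^+ q
                + pospart (t + (2 * b - a)) ^+ q).

Lemma Psi_is_derive {R : realType} (q : nat) (a b l t : R) :
  is_derive t 1 (Psi q.+2 a b l) (Psi q.+1 a b l t).
Proof.
have da := is_derive_pospart q a t.
have db := is_derive_pospart q b t.
have dc := is_derive_pospart q (2 * b - a) t.
have := is_deriveZ (l / q.+2`!%:R) (is_deriveD (is_deriveB da (is_deriveZ 2 db)) dc).
move=> h; apply: is_derive_eq h _; rewrite /GRing.scale/= /Psi factS natrM.
have f0 : (q.+1)`!%:R != 0 :> R by rewrite pnatr_eq0 -lt0n fact_gt0.
have q0 : 2 + q%:R != 0 :> R by rewrite -natrD pnatr_eq0.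
by field; rewrite q0 f0.
Qed.

Lemma Psi_phi1 {R : realType} (a b l t : R) : b < a ->
  phi 1 a b l t = Psi 1 a b l t.
Proof.
move=> ba; rewrite /phi /Psi (_ : 1`!%:R = 1 :> R)// divr1 !expr1; congr (l * _).
case: (pospart_cases (t + a)) => -[H1 ->];
case: (pospart_cases (t + b)) => -[H2 ->];
case: (pospart_cases (t + (2 * b - a))) => -[H3 ->];
match goal with |- pospart ?x = _ => case: (pospart_cases x) => -[H4 ->] end; lra.
Qed.

Lemma Psi1_ge0 {R : realType} (a b l t : R) : 0 < l -> b < a ->
  0 <= Psi 1 a b l t.
Proof.
by move=> l0 ba; rewrite -Psi_phi1// /phi mulr_ge0 ?(ltW l0)// /pospart le_max lexx orbT.
Qed.

Lemma Psi_le {R : realType} (q : nat) (a b l t : R) : b < a -> t <= - a ->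
  Psi q.+1 a b l t = 0.
Proof.
move=> ba ta; rewrite /Psi !pospart_le0E; [|lra..].
by rewrite !expr0n/= mulr0 subr0 addr0 mulr0.
Qed.

Lemma Psi_continuous {R : realType} (q : nat) (a b l : R) : continuous (Psi q.+1 a b l).
Proof.
have pc (c : R) : continuous (fun t : R => pospart (t + c)).
  move=> t; apply: (@continuous_max _ R^o (fun t => t + c) (fun=> 0)).
    by apply: cvgD; [exact: cvg_id|exact: cvg_cst].
  exact: cvg_cst.
have pcX (c : R) : continuous (fun t : R => pospart (t + c) ^+ q.+1).
  by move=> t; apply: (@continuous_comp _ _ _ (fun t => pospart (t + c)) (fun y => y ^+ q.+1));
    [exact: pc|exact: exprn_continuous].
move=> t; apply: cvgM; first exact: cvg_cst.
apply: cvgD; last exact: pcX.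
apply: cvgB; first exact: pcX.
by apply: cvgM; [exact: cvg_cst|exact: pcX].
Qed.

(** The integrand vanishes to the left of -a, so the improper integral is over a
segment and the fundamental theorem of calculus applies. *)
Lemma Rintegral_Psi {R : realType} (q : nat) (a b l t : R) : b < a ->
  \int[lebesgue_measure]_(s in `]-oo, t]) Psi q.+1 a b l s = Psi q.+2 a b l t.
Proof.
move=> ba; pose m := Num.min (- a) t - 1.
have mt : m < t by rewrite /m ltrBlDr (@le_lt_trans _ _ t) ?ge_min ?lexx ?orbT// ltrDl.
have ma : m <= - a.
  by rewrite /m lerBlDr (@le_trans _ _ (- a)) ?ge_min ?lexx// lerDl.
transitivity (\int[lebesgue_measure]_(s in `[m, t]) Psi q.+1 a b l s).
  rewrite Rintegral_mkcond [RHS]Rintegral_mkcond; congr Rintegral.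
  apply/funext => s; rewrite !patchE !mem_setE !in_itv/=.
  have [sm|ms] := ltP s m => //=.
  by rewrite Psi_le ?if_same// ltW// (lt_le_trans sm).
rewrite /Rintegral.
rewrite (@continuous_FTC2 _ _ (Psi q.+2 a b l) _ _ mt).
- by rewrite (Psi_le _ _ ba ma) sube0.
- by apply: continuous_subspaceT => x; exact: Psi_continuous.
- split.
  + by move=> x _; have [] := Psi_is_derive q a b l x.
  + by apply: cvg_at_right_filter; exact: Psi_continuous.
  + by apply: cvg_at_left_filter; exact: Psi_continuous.
- by move=> x _; rewrite derive1E; have [_ ->] := Psi_is_derive q a b l x.
Qed.

Lemma phiE {R : realType} (q : nat) (a b l : R) : b < a ->
  phi q.+1 a b l = Psi q.+1 a b l.
Proof.
move=> ba; elim: q => [|q IH]; apply/funext => t; first exact: Psi_phi1.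
rewrite -Rintegral_Psi// -IH.
by [].
Qed.

(** * The extremal functions belong to the class *)

Section Psi_derivatives.
Context {R : realType}.
Variables (a b l : R).

Lemma Psi_rderiv (q : nat) (C t : R) :
  rderiv (fun s => Psi q.+2 a b l s + C) t (Psi q.+1 a b l t).
Proof.
apply: is_derive_rderiv.
have h := is_deriveD (Psi_is_derive q a b l t) (is_derive_cst C t 1).
by apply: is_derive_eq h _; rewrite addr0.
Qed.

Lemma derivk_Psi (r k : nat) (C : R) : (k < r)%N ->
  {in Rminus, derivk k (fun t => Psi r a b l t + C) =1
              fun t => Psi (r - k) a b l t + C *+ (k == 0)%N}.
Proof.
elim: k => [|k IH] kr t t0; first by rewrite subn0 mulr1n.
have {}IH := IH (ltnW kr).
rewrite /derivk iterS -/(derivk _ _) (eq_deriv1 IH)// mulr0n addr0.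
apply: deriv1E; first by move: t0; rewrite inE RminusE.
have -> : (r - k = (r - k).-2.+2)%N by lia.
have -> : (r - k.+1 = (r - k).-2.+1)%N by lia.
exact: Psi_rderiv.
Qed.

Lemma derivk_Psi_rderiv (r k : nat) (C t : R) : (k.+1 < r)%N -> t <= 0 ->
  rderiv (derivk k (fun t => Psi r a b l t + C)) t (Psi (r - k.+1) a b l t).
Proof.
move=> kr t0; apply: (@eq_rderiv _ (fun t => Psi (r - k) a b l t + C *+ (k == 0)%N)) => //.
  by move=> s s0; rewrite derivk_Psi// ltnW.
have -> : (r - k = (r - k).-2.+2)%N by lia.
have -> : (r - k.+1 = (r - k).-2.+1)%N by lia.
exact: Psi_rderiv.
Qed.

(** Derivative of the hat away from its kinks: 0, then l, -l, and 0 again. *)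
Definition saw (t : R) : R := l * (step a t - 2 * step b t + step (2 * b - a) t).

Definition kinks : seq R := [:: - a; - b; - (2 * b - a)].

Lemma Psi1_rderiv (C t : R) : t \notin kinks ->
  rderiv (fun s => Psi 1 a b l s + C) t (saw t).
Proof.
rewrite !inE !negb_or => /and3P[ta tb tc]; apply: is_derive_rderiv.
have da := is_derive_pospart1 ta.
have db := is_derive_pospart1 tb.
have dc := is_derive_pospart1 tc.
have := is_deriveD (is_deriveZ l (is_deriveD (is_deriveB da (is_deriveZ 2 db)) dc))
  (is_derive_cst C t 1).
rewrite (_ : _ + cst C = fun s => Psi 1 a b l s + C).
  by move=> h; apply: is_derive_eq h _; rewrite addr0.
by apply/funext => s; rewrite /Psi (_ : 1`!%:R = 1 :> R)// divr1 !expr1.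
Qed.

Lemma derivk_top (r : nat) (C t : R) : (0 < r)%N -> t <= 0 -> t \notin kinks ->
  rderiv (derivk r.-1 (fun t => Psi r a b l t + C)) t (saw t).
Proof.
case: r => //= r _ t0 tk.
apply: (@eq_rderiv _ (fun t => Psi 1 a b l t + C *+ (r == 0)%N)) => //.
  by move=> s s0; rewrite derivk_Psi// subSnn.
exact: Psi1_rderiv.
Qed.

Lemma derivk_topE (r : nat) (C t : R) : (0 < r)%N -> t <= 0 -> t \notin kinks ->
  derivk r (fun t => Psi r a b l t + C) t = saw t.
Proof.
move=> r0 t0 tk; rewrite -[in LHS](prednK r0) /derivk iterS -/(derivk _ _).
by apply: deriv1E => //; rewrite (prednK r0); exact: derivk_top.
Qed.

Hypotheses (l0 : 0 < l) (ba : b < a).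

Let homo_of_ge0 (q : nat) : (forall t, t <= 0 -> 0 <= Psi q.+1 a b l t) ->
  forall s t, s <= t -> t <= 0 -> Psi q.+2 a b l s <= Psi q.+2 a b l t.
Proof.
move=> P0 s t st t0; apply: (rderiv_ge0_homo t0 _ _ st).
  by move=> u _; exact/is_derive_rderiv/Psi_is_derive.
by move=> u /andP[_ ut]; apply: P0; rewrite (le_trans (ltW ut)).
Qed.

Lemma Psi_ge0 (q : nat) (t : R) : t <= 0 -> 0 <= Psi q.+1 a b l t.
Proof.
elim: q t => [|q IH] t t0; first exact: Psi1_ge0.
(* Writes 0 as a value of Psi to the left of t. *)
rewrite -(@Psi_le _ q.+1 a b l (Num.min t (- a))) ?ge_min ?lexx ?orbT//.
by apply: homo_of_ge0 => //; rewrite ge_min lexx.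
Qed.

Lemma Psi_homo (q : nat) (s t : R) : s <= t -> t <= 0 ->
  Psi q.+2 a b l s <= Psi q.+2 a b l t.
Proof. by apply: homo_of_ge0 => u; exact: Psi_ge0. Qed.

Lemma linf_norm_derivk_Psi (r k : nat) (C : R) : 0 <= C -> (k.+1 < r)%N ->
  linf_norm (derivk k (fun t => Psi r a b l t + C)) =
  (Psi (r - k) a b l 0 + C *+ (k == 0)%N)%:E.
Proof.
move=> C0 kr; rewrite (eq_linf_norm (derivk_Psi C (ltnW kr))).
have -> : (r - k = (r - k).-2.+2)%N by lia.
apply: (@linf_norm_homo _ (fun t => Psi (r - k).-2.+2 a b l t + C *+ (k == 0)%N)
  (Psi (r - k).-2.+1 a b l 0)).
- by move=> s t st t0; rewrite lerD2r Psi_homo.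
- by move=> t t0; rewrite addr_ge0 ?Psi_ge0// mulrn_wge0.
- exact: Psi_rderiv.
Qed.

(** Since 2b - a < b < a, the three steps are switched on in the order a, b, 2b - a,
and the bracket takes the values 0, 1, -1, 0. *)
Lemma saw_le (t : R) : `|saw t| <= l.
Proof.
rewrite /saw normrM (gtr0_norm l0) -[leRHS]mulr1 ler_pM2l// ler_norml /step.
case: (ltP (- a) t) => ta; case: (ltP (- b) t) => tb;
  case: (ltP (- (2 * b - a)) t) => tc /=; lra.
Qed.

Lemma saw_rise (t : R) : - a < t < - b -> t \notin kinks /\ saw t = l.
Proof.
move=> /andP[ta tb]; split.
  rewrite !inE !negb_or; apply/and3P; split; [rewrite gt_eqF//|rewrite lt_eqF//|].
  by rewrite lt_eqF//; lra.
rewrite /saw /step ta (_ : - b < t = false) 1?(_ : - (2 * b - a) < t = false).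
- by rewrite mulr0 subr0 addr0 mulr1.
- by apply/negbTE; rewrite -leNgt; lra.
- by apply/negbTE; rewrite -leNgt; lra.
Qed.

Lemma linf_norm_derivk_top (r : nat) (C : R) : (0 < r)%N -> 0 <= b ->
  linf_norm (derivk r (fun t => Psi r a b l t + C)) = l%:E.
Proof.
move=> r0 b0; apply/eqP; rewrite eq_le; apply/andP; split.
  apply/linf_norm_leP; first exact: ltW.
  apply: ae_lebesgueS (ae_lebesgue_notin kinks) => t tk; rewrite RminusE => t0.
  by rewrite derivk_topE// saw_le.
apply: (@linf_norm_ge _ _ _ (- a) (- b)); rewrite ?ltrN2 ?oppr_le0//.
move=> t tab; have [tk sl] := saw_rise tab.
rewrite derivk_topE// ?sl ?ger0_norm ?(ltW l0)//.
by move: tab => /andP[_ /ltW/le_trans]; apply; rewrite oppr_le0.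
Qed.

End Psi_derivatives.

(** At a kink the r-th derivative of an extremal function has an unspecified value;
measurability is not affected by finitely many such values. *)
Lemma measurable_fun_eq_notin {R : realType} (s : seq R) (f g : R -> R) :
  measurable_fun setT g -> (forall t, t \notin s -> f t = g t) ->
  measurable_fun setT f.
Proof.
move=> mg; elim: s f => [|p s IH] f fg.
  by rewrite (_ : f = g)//; apply/funext => t; exact: fg.
rewrite (_ : f = fun t => if t == p then f p else (if t == p then g p else f t)).
  apply: measurable_fun_ifT => //; first exact: measurable_fun_eqr.
  apply: IH => t ts; case: eqP => [->//|/eqP tp].
  by apply: fg; rewrite inE negb_or tp.
by apply/funext => t; case: eqP => [->|].
Qed.

Lemma in_linf_bounded {R : realType} (f : R -> R) :
  measurable_fun setT (f \_ Rminus) -> (linf_norm f < +oo)%E -> in_linf f.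
Proof.
move=> mf fy; rewrite /in_linf inE; apply/andP; split; rewrite inE//=.
Qed.

Lemma lipschitz_loc_abs_continuous {R : realType} (f : R -> R) (K : R) :
  0 <= K -> (forall s t, s <= t -> t <= 0 -> `|f t - f s| <= K * (t - s)) ->
  loc_abs_continuous f.
Proof.
move=> K0 fK a b ab b0 e e0; have k0 : 0 < K + 1 by lra.
exists (e / (K + 1)); first by rewrite divr_gt0.
move=> n u v uv _; rewrite ltr_pdivlMr// => sd.
apply: le_lt_trans sd; rewrite mulr_suml; apply: ler_sum => i _.
have [_ uvi vb] := uv i; rewrite (le_trans (fK _ _ uvi (le_trans vb b0)))//.
by rewrite mulrC ler_wpM2l ?subr_ge0// lerDl.
Qed.

Lemma pospart_lipschitz {R : realType} (s t : R) : s <= t ->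
  `|pospart t - pospart s| <= t - s.
Proof.
move=> st; case: (pospart_cases s) => -[? ->]; case: (pospart_cases t) => -[? ->];
  rewrite ler_norml; lra.
Qed.

Lemma Psi1_lipschitz {R : realType} (a b l C s t : R) : 0 < l -> s <= t ->
  `|(Psi 1 a b l t + C) - (Psi 1 a b l s + C)| <= 4 * l * (t - s).
Proof.
move=> l0 st; rewrite /Psi (_ : 1`!%:R = 1 :> R)// divr1 !expr1.
have H c : `|pospart (t + c) - pospart (s + c)| <= t - s.
  by rewrite (le_trans (pospart_lipschitz _)) ?lerD2r//; lra.
have := H a; have := H b; have := H (2 * b - a).
rewrite !ler_norml => /andP[h1 h2] /andP[h3 h4] /andP[h5 h6].
apply/andP; split.
  by rewrite -subr_ge0; nra.
by rewrite -subr_ge0; nra.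
Qed.

Lemma measurable_saw {R : realType} (a b l : R) : measurable_fun setT (saw a b l).
Proof.
have ms (c : R) : measurable_fun setT (step c).
  rewrite (_ : step c = \1_(`]- c, +oo[%classic)).
    by apply: measurable_indic; exact: measurable_itv.
  by apply/funext => t; rewrite indicE mem_setE in_itv/= andbT.
apply: measurable_funM => //; apply: measurable_funD => //.
by apply: measurable_funB => //; exact: measurable_funM.
Qed.

Lemma Psi_Lrm {R : realType} (r : nat) (a b l C : R) : (1 < r)%N ->
  0 < l -> 0 <= b < a -> 0 <= C ->
  Lrm_infinf r r.-1 (fun t => Psi r a b l t + C).
Proof.
move=> r1 l0 /andP[b0 ba] C0; have r0 := ltnW r1.
have rr : (r.-1 < r)%N by rewrite ltn_predL.
have mR : measurable (Rminus : set R) by exact: measurable_itv.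
split.
- split; first split.
  + move=> k t kr; rewrite RminusE => t0; apply: rderiv_has.
    by apply: derivk_Psi_rderiv => //; lia.
  + apply: (@lipschitz_loc_abs_continuous _ _ (4 * l)).
      by rewrite mulr_ge0// ltW.
    move=> s t st t0; rewrite !derivk_Psi ?inE ?RminusE//; last exact: le_trans t0.
    have -> : (r - r.-1 = 1)%N by lia.
    exact: Psi1_lipschitz.
  + apply: ae_lebesgueS (ae_lebesgue_notin (kinks a b)) => t tk.
    by rewrite RminusE => t0; exact/rderiv_has/derivk_top.
  + apply: in_linf_bounded; last by rewrite linf_norm_derivk_top// ltry.
    apply: (@measurable_fun_eq_notin _ (kinks a b) _ (saw a b l \_ Rminus)).
      by apply/(measurable_restrictT _ mR)/measurable_funTS; exact: measurable_saw.
    move=> t tk; rewrite !patchE; case: ifPn => //; rewrite inE RminusE => t0.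
    exact: derivk_topE.
  + apply: in_linf_bounded.
      apply/(measurable_restrictT _ mR)/measurable_funTS.
      apply: continuous_measurable_fun => t.
      apply: cvgD; last exact: cvg_cst.
      by rewrite -(prednK r0); exact: Psi_continuous.
    have := @linf_norm_derivk_Psi _ _ _ _ l0 ba r 0 C C0 r1.
    by move=> ->; rewrite ltry.
- move=> k t kr kr'; rewrite RminusE => t0; rewrite derivk_Psi ?inE ?RminusE//.
  have -> : (r - k = (r - k).-1.+1)%N by lia.
  by rewrite addr_ge0 ?Psi_ge0// mulrn_wge0.
- by move=> h; move: rr; rewrite h ltnn.
Qed.

(** * Choosing the vertices of the hat *)

(** Up to the factor n (n-1), the moment of order n-2 of the hat of slope 1 with
vertices 1, y and 2y - 1 (cut off at 0), in the variable -t. *)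
Definition hat_moment {R : realType} (n : nat) (y : R) : R :=
  1 - 2 * y ^+ n + pospart (2 * y - 1) ^+ n.

(** With p = (2y-1)_+, the difference of the two sides is
2 y^(n+1) (1-y) - p^(n+1) (1-p); if p > 0, then 1 - p = 2 (1-y) and p <= y. *)
Lemma hat_moment_ndecr {R : realType} (n : nat) (y : R) : 0 <= y <= 1 ->
  hat_moment n.+1 y <= hat_moment n.+2 y.
Proof.
move=> /andP[y0 y1]; rewrite /hat_moment.
suff : pospart (2 * y - 1) ^+ n.+1 * (1 - pospart (2 * y - 1)) <=
    2 * (y ^+ n.+1 * (1 - y)) by rewrite (exprSr _ n.+1) (exprSr (pospart _) n.+1); lra.
case: (pospart_cases (2 * y - 1)) => -[h ->].
  by rewrite expr0n/= mul0r mulr_ge0// mulr_ge0 ?exprn_ge0//; lra.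
rewrite (_ : 1 - (2 * y - 1) = 2 * (1 - y)); last by ring.
rewrite mulrCA ler_pM2l// ler_wpM2r//; first lra.
by apply: lerXn2r; rewrite ?nnegrE//; lra.
Qed.

Lemma hat_moment_gt0 {R : realType} (n : nat) (y : R) : 0 <= y < 1 ->
  0 < hat_moment n.+2 y.
Proof.
move=> /andP[y0 y1]; elim: n => [|n IH].
  rewrite /hat_moment; case: (pospart_cases (2 * y - 1)) => -[h ->]; rewrite !expr2; nra.
by rewrite (lt_le_trans IH)// hat_moment_ndecr// y0 ltW.
Qed.

Lemma hat_moment_leq {R : realType} (m n : nat) (y : R) : (m <= n)%N -> 0 <= y <= 1 ->
  hat_moment m.+1 y <= hat_moment n.+1 y.
Proof.
move=> mn y01; rewrite -(subnK mn) addnC; elim: (n - m)%N => [|k IH].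
  by rewrite addn0.
by rewrite addnS (le_trans IH)// hat_moment_ndecr.
Qed.

Lemma hat_moment0 {R : realType} (n : nat) : hat_moment n.+1 0 = 1 :> R.
Proof.
by rewrite /hat_moment pospart_le0E ?mulr0 ?sub0r ?oppr_le0// expr0n/= mulr0 subr0 addr0.
Qed.

Lemma hat_moment1 {R : realType} (n : nat) : hat_moment n 1 = 0 :> R.
Proof.
rewrite /hat_moment (_ : 2 * 1 - 1 = 1 :> R); last by ring.
by rewrite pospart_ge0E// !expr1n; ring.
Qed.

Lemma hat_moment_continuous {R : realType} (n : nat) : continuous (@hat_moment R n).
Proof.
have pc : continuous (fun y : R => pospart (2 * y - 1)).
  move=> y; apply: (@continuous_max _ R^o (fun y => 2 * y - 1) (fun=> 0)).
    apply: cvgB; last exact: cvg_cst.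
    by apply: cvgM; [exact: cvg_cst|exact: cvg_id].
  exact: cvg_cst.
move=> y; apply: cvgD.
  apply: cvgB; first exact: cvg_cst.
  by apply: cvgM; [exact: cvg_cst|exact: exprn_continuous].
by apply: (@continuous_comp _ _ _ (fun y : R => pospart (2 * y - 1))
  (fun z => z ^+ n)); [exact: pc|exact: exprn_continuous].
Qed.

(** The quotient of the n3-th power of the moment n2 by the n2-th power of the
moment n3 is what remains of the two moments once the scale is eliminated.  At
y = 0 both moments are 1 and P <= Q decides the sign.  As y tends to 1 the
moments tend to 0, but the moment n2 stays above the moment n3 and is raised to
the smaller power, so the sign is reversed. *)
Lemma hat_moment_ratio {R : realType} (n3 n2 : nat) (P Q : R) :
  (1 < n3)%N -> (n3 < n2)%N -> 0 < P -> 0 < Q -> P <= Q ->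
  exists2 y, 0 <= y < 1 & hat_moment n2 y ^+ n3 * P = Q * hat_moment n3 y ^+ n2.
Proof.
move=> n31 n32 P0 Q0 PQ.
pose G y : R := hat_moment n2 y ^+ n3 * P - Q * hat_moment n3 y ^+ n2.
have Gc : continuous G.
  have sc n k : continuous (fun y : R => hat_moment n y ^+ k).
    by move=> y; apply: (@continuous_comp _ _ _ (@hat_moment R n) (fun z => z ^+ k));
      [exact: hat_moment_continuous|exact: exprn_continuous].
  move=> y; apply: cvgB.
    by apply: cvgM; [exact: sc|exact: cvg_cst].
  by apply: cvgM; [exact: cvg_cst|exact: sc].
have En3 : n3 = n3.-2.+2 by lia.
have En2 : n2 = n2.-2.+2 by lia.
have G0 : G 0 <= 0.
  by rewrite /G {1}En2 {2}En3 !hat_moment0 !expr1n mul1r mulr1 subr_le0.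
have [y1 /andP[y10 y11] Gy1] : exists2 y, 0 <= y < 1 & 0 < G y.
  (* It suffices that the moment n3 be less than 1 and P / Q: then one of
     the extra factors beats Q / P and the others are at most 1. *)
  have e0 : 0 < Num.min 1 (P / Q) by rewrite lt_min ltr01 divr_gt0.
  have /cvgrPdist_lt /(_ _ e0) /nbhs_ballP[h/= h0] := @hat_moment_continuous R n3 1.
  rewrite hat_moment1 => hP.
  (* Close to 1, but still non-negative. *)
  pose y := 1 - Num.min 1 h / 2.
  have m0 : 0 < Num.min 1 h by rewrite lt_min ltr01.
  have m1 : Num.min 1 h <= 1 by rewrite ge_min lexx.
  have mh : Num.min 1 h <= h by rewrite ge_min lexx orbT.
  have y0 : 0 <= y by rewrite /y; lra.
  have y1 : y < 1 by rewrite /y; lra.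
  exists y; first by rewrite y0.
  have s3 : 0 < hat_moment n3 y by rewrite En3; apply: hat_moment_gt0; rewrite y0.
  have s32 : hat_moment n3 y <= hat_moment n2 y.
    by rewrite En3 En2; apply: hat_moment_leq; [lia|rewrite y0 ltW].
  have := hP y; rewrite /ball/= sub0r normrN (gtr0_norm s3) lt_min.
  have -> : `|1 - y| = Num.min 1 h / 2 by rewrite ger0_norm /y; lra.
  have -> : Num.min 1 h / 2 < h by lra.
  move=> /(_ isT)/andP[sl1]; rewrite ltr_pdivlMr// => slP.
  rewrite /G subr_gt0; apply: (@lt_le_trans _ _ (hat_moment n3 y ^+ n3 * P)); last first.
    by rewrite ler_pM2r//; apply: lerXn2r; rewrite ?nnegrE// ltW// (lt_le_trans s3).
  rewrite [X in Q * _ ^+ X](_ : n2 = n3 + (n2 - n3).-1.+1)%N; last first.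
    by rewrite prednK ?subn_gt0// subnKC// ltnW.
  rewrite exprD mulrCA ltr_pM2l ?exprn_gt0// exprS.
  apply: le_lt_trans slP; rewrite mulrC -mulrA ler_pM2l//.
  by rewrite mulrC ler_piMr ?(ltW Q0)// exprn_ile1// ltW.
have [||y] := @IVT _ G 0 y1 0 y10.
- exact: continuous_subspaceT.
- by rewrite minEle maxEle (le_trans G0 (ltW Gy1)) G0 ltW.
rewrite in_itv/= => /andP[y0 yy1] /eqP; rewrite subr_eq0 => /eqP Gy.
by exists y => //; rewrite y0 (le_lt_trans yy1).
Qed.

Lemma scale_hat_moment {R : realType} (n : nat) (s y : R) : 0 <= s ->
  s ^+ n - 2 * (s * y) ^+ n + pospart (2 * (s * y) - s) ^+ n = s ^+ n * hat_moment n y.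
Proof.
move=> s0; rewrite (_ : 2 * (s * y) - s = s * (2 * y - 1)); last by ring.
by rewrite pospartM// !exprMn /hat_moment; ring.
Qed.

Lemma nth_root_ex {R : realType} (n : nat) (K : R) : (0 < n)%N -> 0 < K ->
  exists2 s, 0 < s & s ^+ n = K.
Proof.
move=> n0 K0; exists (K `^ n%:R^-1); first exact: powR_gt0.
by rewrite -powR_mulrn ?powR_ge0// -powRrM mulVf ?powRr1 ?ltW// pnatr_eq0 -lt0n.
Qed.

(** The number rho is the length of the ramp (the case b = 0) whose moment of the
lower order is the prescribed one; the bound on B2 says that the prescribed
moment of the higher order is at least that of this ramp. *)
Lemma hat_ex {R : realType} (n3 n2 : nat) (B3 B2 rho : R) :
  (1 < n3)%N -> (n3 < n2)%N -> 0 < B3 -> 0 < rho -> rho ^+ n3 = B3 ->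
  rho ^+ n2 <= B2 ->
  exists a b : R, [/\ 0 <= b < a,
    a ^+ n3 - 2 * b ^+ n3 + pospart (2 * b - a) ^+ n3 = B3 &
    a ^+ n2 - 2 * b ^+ n2 + pospart (2 * b - a) ^+ n2 = B2].
Proof.
move=> n31 n32 B30 rho0 rhoE B2l.
have r2 : 0 < rho ^+ n2 by rewrite exprn_gt0.
have B20 : 0 < B2 by exact: lt_le_trans B2l.
have n30 : (0 < n3)%N by exact: ltnW.
have [|||y /andP[y0 y1] yE] :=
  @hat_moment_ratio _ n3 n2 ((rho ^+ n2) ^+ n3) (B2 ^+ n3) n31 n32.
- by rewrite exprn_gt0.
- by rewrite exprn_gt0.
- by apply: lerXn2r; rewrite ?nnegrE// ltW.
have En3 : n3 = n3.-2.+2 by lia.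
have En2 : n2 = n2.-2.+2 by lia.
have s3 : 0 < hat_moment n3 y by rewrite En3; apply: hat_moment_gt0; rewrite y0.
have s2 : 0 < hat_moment n2 y by rewrite En2; apply: hat_moment_gt0; rewrite y0.
have [s s0 sE] := nth_root_ex n30 (divr_gt0 B30 s3).
exists s, (s * y); rewrite !scale_hat_moment ?(ltW s0)//; split.
- by rewrite mulr_ge0 ?(ltW s0)//= gtr_pMr.
- by rewrite sE divfK ?gt_eqF.
- apply/eqP; rewrite -(@eqrXn2 _ n3) ?mulr_ge0 ?exprn_ge0 ?(ltW s0) ?(ltW s2) ?(ltW B20)//.
  rewrite exprMn exprAC sE -rhoE expr_div_n (exprAC rho).
  by rewrite mulrAC (mulrC _ (hat_moment n2 y ^+ n3)) yE mulfK// gt_eqF// exprn_gt0.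
Qed.

(** * Comparing a member of the class with an extremal function *)

Lemma Psi_at0 {R : realType} (q : nat) (a b l : R) : 0 <= b < a ->
  Psi q a b l 0 = l / q`!%:R * (a ^+ q - 2 * b ^+ q + pospart (2 * b - a) ^+ q).
Proof.
move=> /andP[b0 ba]; rewrite /Psi !add0r (pospart_ge0E b0) pospart_ge0E//.
by rewrite (le_trans b0)// ltW.
Qed.

Section Psi1_pieces.
Context {R : realType} (a b l : R).

Lemma Psi1_rise (t : R) : b < a -> - a <= t <= - b -> Psi 1 a b l t = l * (t + a).
Proof.
move=> ba /andP[ta tb]; rewrite /Psi (_ : 1`!%:R = 1 :> R)// divr1 !expr1.
by rewrite pospart_ge0E ?pospart_le0E; [congr (_ * _); ring|lra..].
Qed.

Lemma Psi1_fall (t : R) : b < a -> - b <= t <= a - 2 * b ->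
  Psi 1 a b l t = l * (a - 2 * b - t).
Proof.
move=> ba /andP[tb tc]; rewrite /Psi (_ : 1`!%:R = 1 :> R)// divr1 !expr1.
rewrite (pospart_ge0E (_ : 0 <= t + a)); last lra.
rewrite (pospart_ge0E (_ : 0 <= t + b)); last lra.
by rewrite pospart_le0E; [congr (_ * _); ring|lra].
Qed.

Lemma Psi1_right (t : R) : b < a -> a - 2 * b <= t -> Psi 1 a b l t = 0.
Proof.
move=> ba tc; rewrite /Psi (_ : 1`!%:R = 1 :> R)// divr1 !expr1.
by rewrite !pospart_ge0E; [ring|lra..].
Qed.

End Psi1_pieces.

Section members_of_the_class.
Context {R : realType}.
Variables (r : nat) (x : R -> R).
Hypothesis xL : Lrm_infinf r r.-1 x.

Lemma derivk_member_ge0 (k : nat) (t : R) : (k < r)%N -> t <= 0 -> 0 <= derivk k x t.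
Proof.
move=> kr t0; have [_ h _] := xL; apply: h; rewrite ?RminusE//.
by rewrite -ltnS (ltn_predK kr).
Qed.

Lemma derivk_member_rderiv (k : nat) (t : R) : (k.+1 < r)%N -> t <= 0 ->
  rderiv (derivk k x) t (derivk k.+1 x t).
Proof.
move=> kr t0; have [[[h _ _ _] _] _ _] := xL; apply: has_derivP => //.
by apply: h; rewrite ?RminusE//; lia.
Qed.

Lemma linf_norm_derivk_member (k : nat) : (k.+1 < r)%N ->
  linf_norm (derivk k x) = (derivk k x 0)%:E.
Proof.
move=> kr; apply: linf_norm_homo (derivk_member_rderiv kr (lexx _)).
- move=> s t st t0; apply: (rderiv_ge0_homo (f' := derivk k.+1 x) t0 _ _ st).
    by move=> u /andP[_ ut]; apply: derivk_member_rderiv => //; exact: le_trans t0.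
  by move=> u /andP[_ ut]; apply: derivk_member_ge0 => //; exact: le_trans (ltW ut) t0.
- by move=> t; apply: derivk_member_ge0; exact: ltnW.
Qed.

Variables (a b l : R).
Hypothesis ab : 0 <= b < a.

(** The difference x^(k) - phi_r^(k) whose sign changes are counted. *)
Definition gap (k : nat) (t : R) : R := derivk k x t - Psi (r - k) a b l t.

Lemma gap_rderiv (k : nat) (t : R) : (k < r.-1)%N -> - a <= t <= 0 ->
  rderiv (gap k) t (gap k.+1 t).
Proof.
move=> kr /andP[_ t0]; have /andP[_ ba] := ab.
apply: rderivB; first by apply: derivk_member_rderiv => //; lia.
have -> : (r - k = (r - k).-2.+2)%N by lia.
have -> : (r - k.+1 = (r - k).-2.+1)%N by lia.
exact/is_derive_rderiv/Psi_is_derive.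
Qed.

(** At -a and before, phi_r and its derivatives vanish. *)
Lemma gap_left (k : nat) : (k < r)%N -> 0 <= gap k (- a).
Proof.
move=> kr; have /andP[b0 ba] := ab; rewrite /gap.
rewrite (_ : r - k = (r - k).-1.+1)%N; last by lia.
rewrite Psi_le// subr0; apply: derivk_member_ge0 => //; lra.
Qed.

Hypothesis l0 : 0 < l.
Hypothesis xl : linf_norm (derivk r x) = l%:E.

(** This is where the norm of the derivative of order r enters. *)
Lemma derivk_member_lipschitz (s t : R) : (0 < r)%N -> s <= t -> t <= 0 ->
  `|derivk r.-1 x t - derivk r.-1 x s| <= l * (t - s).
Proof.
move=> r0 st t0; have [[[_ ac ad _] _] _ _] := xL.
apply: abs_continuous_lipschitz => //; [exact: ltW|exact: ac|].
have : (linf_norm (derivk r x) <= l%:E)%E by rewrite xl.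
move=> /(linf_norm_leP _ (ltW l0)) al.
apply: ae_lebesgueS (ae_lebesgueI ad al) => u [ud ul] u0.
exists (derivk r x u); first exact: ul.
rewrite -[in derivk r x u](prednK r0); apply: has_derivP; first by rewrite -RminusE.
exact: ud.
Qed.

(** On the rising side of the hat the gap is non-increasing, because the slope of
the hat is the largest allowed; on the falling side it is non-decreasing; and
beyond the hat it is non-negative.  So it cannot be positive between two
negative values. *)
Lemma gap_no_pos_between_neg : (0 < r)%N -> no_pos_between_neg (- a) (gap r.-1).
Proof.
move=> r0 s t u As st tu u0; have /andP[b0 ba] := ab.
have t0 : t <= 0 by exact: le_trans u0.
rewrite /gap (_ : r - r.-1 = 1)%N; last by lia.
have Lst := derivk_member_lipschitz r0 st t0; have Ltu := derivk_member_lipschitz r0 tu u0.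
have gu := @derivk_member_ge0 r.-1 u; have {gu} gu : 0 <= derivk r.-1 x u.
  by apply: gu => //; lia.
move: Lst Ltu gu.
set gs := derivk _ _ s; set gt := derivk _ _ t; set gu := derivk _ _ u.
move=> Lst Ltu gu0.
move: Lst Ltu; rewrite !ler_norml => /andP[_ Lst] /andP[Ltu _].
have [tb|bt] := leP t (- b).
  rewrite (@Psi1_rise _ a b l s)//; last by apply/andP; split; lra.
  rewrite (@Psi1_rise _ a b l t)//; last by apply/andP; split; lra.
  by move=> *; lra.
have [uc|cu] := leP u (a - 2 * b).
  rewrite (@Psi1_fall _ a b l t)//; last by apply/andP; split; lra.
  rewrite (@Psi1_fall _ a b l u)//; last by apply/andP; split; lra.
  by move=> *; lra.
by rewrite (@Psi1_right _ a b l u)//; [move=> *; lra|exact: ltW].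
Qed.

End members_of_the_class.

(** * The two inequalities *)

Lemma linf_norm_derivk_phi {R : realType} (r k : nat) (a b l : R) :
  0 < l -> 0 <= b < a -> (k.+1 < r)%N ->
  linf_norm (derivk k (phi r a b l)) = (Psi (r - k) a b l 0)%:E.
Proof.
move=> l0 /andP[b0 ba] kr.
have -> : phi r a b l = fun t => Psi r a b l t + 0.
  by apply/funext => t; rewrite addr0 -(ltn_predK kr) phiE.
by rewrite linf_norm_derivk_Psi// mul0rn addr0.
Qed.

Lemma Phi_paramsP {R : realType} (r k2 k3 : nat) (M2 M3 Mr a b l : R) :
  (k2 < k3)%N -> (k3.+1 < r)%N ->
  Phi_params r k2 k3 M2 M3 Mr (a, b, l) <->
  [/\ 0 < Mr, l = Mr, 0 <= b < a, Psi (r - k2) a b l 0 = M2 &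
      Psi (r - k3) a b l 0 = M3].
Proof.
move=> k23 k3r; have k2r : (k2.+1 < r)%N by lia.
have r0 : (0 < r)%N by lia.
have top : 0 < l -> 0 <= b < a -> linf_norm (derivk r (phi r a b l)) = l%:E.
  move=> l0 /andP[b0 ba].
  have -> : phi r a b l = fun t => Psi r a b l t + 0.
    by apply/funext => t; rewrite addr0 -(ltn_predK r0) phiE.
  exact: linf_norm_derivk_top.
split.
- move=> [l0 ab]; rewrite (linf_norm_derivk_phi l0 ab k2r).
  rewrite (linf_norm_derivk_phi l0 ab k3r) top// => -[E2] [E3] [El].
  by split => //; rewrite -El.
- move=> [Mr0 lE ab E2 E3]; have l0 : 0 < l by rewrite lE.
  split; rewrite ?top ?lE//; last by rewrite linf_norm_derivk_phi// -lE// E3.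
  by rewrite linf_norm_derivk_phi// -lE// E2.
Qed.

(** The right-hand side of (A) is the value at 0 of the derivative of order k2 of
the ramp function, with vertex at -rho, for which the derivative of order k3 has
value M3. *)
Lemma bound_via_root {R : realType} (r k2 k3 : nat) (M3 l rho : R) :
  (k2 < k3)%N -> (k3 < r)%N -> 0 < M3 -> 0 < l -> 0 < rho ->
  rho ^+ (r - k3) = (r - k3)`!%:R * M3 / l ->
  ((r - k3)`!%:R `^ ((r - k2)%:R / (r - k3)%:R)) / (r - k2)`!%:R
    * M3 `^ ((r - k2)%:R / (r - k3)%:R)
    * l `^ ((k2%:R - k3%:R) / (r - k3)%:R)
  = l / (r - k2)`!%:R * rho ^+ (r - k2).
Proof.
move=> k23 k3r M30 l0 rho0 rhoE.
have n30 : (r - k3)%:R != 0 :> R by rewrite pnatr_eq0 -lt0n subn_gt0.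
set p := (r - k2)%:R / _; set q := (_ - _) / _.
have pq : p + q = 1.
  rewrite /p /q -mulrDl !natrB; [|lia..].
  rewrite (_ : _ - _ + _ = r%:R - k3%:R); last by ring.
  by rewrite -natrB ?divff//; lia.
have lq : l `^ p * l `^ q = l.
  by rewrite -powRD ?pq ?powRr1 ?(ltW l0)// (gt_eqF l0) implybT.
have KE : (r - k3)`!%:R `^ p * M3 `^ p = l `^ p * rho ^+ (r - k2).
  rewrite -powRM ?(ltW M30)//.
  rewrite (_ : _ * M3 = l * rho ^+ (r - k3)); last first.
    by rewrite rhoE [RHS]mulrC divfK// gt_eqF.
  rewrite powRM ?(ltW l0) ?exprn_ge0 ?(ltW rho0)//; congr (_ * _).
  rewrite -!powR_mulrn ?(ltW rho0)// -powRrM; congr (_ `^ _).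
  by rewrite /p mulrC divfK.
rewrite -[in RHS]lq.
transitivity ((r - k3)`!%:R `^ p * M3 `^ p * l `^ q / (r - k2)`!%:R); first by ring.
by rewrite KE; ring.
Qed.

Lemma Psi_b0_at0 {R : realType} (q : nat) (a l : R) : 0 < a ->
  Psi q.+1 a 0 l 0 = l / q.+1`!%:R * a ^+ q.+1.
Proof.
move=> a0; rewrite Psi_at0 ?lexx// mulr0 sub0r pospart_le0E ?oppr_le0 ?ltW//.
by rewrite !expr0n/= mulr0 subr0 addr0.
Qed.

(** The case b = 0, in which the hat rises up to 0 and the gap is non-increasing. *)
Lemma gap_no_pos_after_neg {R : realType} (r : nat) (x : R -> R) (l a : R) :
  Lrm_infinf r r.-1 x -> 0 < l -> linf_norm (derivk r x) = l%:E -> 0 < a ->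
  (0 < r)%N -> no_pos_after_neg (- a) (gap r x a 0 l r.-1).
Proof.
move=> xL l0 xl a0 r0 s t As st t0.
rewrite /gap (_ : r - r.-1 = 1)%N; last by lia.
have := derivk_member_lipschitz xL l0 xl r0 st t0; rewrite ler_norml => /andP[_].
by rewrite !Psi1_rise ?oppr0 ?t0 ?As ?(le_trans st) ?(le_trans As)//; lra.
Qed.

Section lower_bounds.
Context {R : realType}.
Variables (r k2 k3 : nat) (x : R -> R) (M2 M3 l : R).
Hypotheses (k20 : (0 < k2)%N) (k23 : (k2 < k3)%N) (k3r : (k3.+1 < r)%N).
Hypotheses (xL : Lrm_infinf r r.-1 x) (l0 : 0 < l).
Hypothesis x2 : linf_norm (derivk k2 x) = M2%:E.
Hypothesis x3 : linf_norm (derivk k3 x) = M3%:E.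
Hypothesis xl : linf_norm (derivk r x) = l%:E.

Let r0 : (0 < r)%N. Proof. by lia. Qed.
Let x2E : derivk k2 x 0 = M2.
Proof. by apply/EFin_inj; rewrite -x2 (linf_norm_derivk_member xL)//; lia. Qed.
Let x3E : derivk k3 x 0 = M3.
Proof. by apply/EFin_inj; rewrite -x3 (linf_norm_derivk_member xL). Qed.

Lemma middle_norm_ge (rho : R) : 0 < rho ->
  rho ^+ (r - k3) = (r - k3)`!%:R * M3 / l ->
  l / (r - k2)`!%:R * rho ^+ (r - k2) <= M2.
Proof.
move=> rho0 rhoE; have ab : 0 <= (0 : R) < rho by rewrite lexx.
have f0 : (r - k3)`!%:R != 0 :> R by rewrite pnatr_eq0 -lt0n fact_gt0.
suff : 0 <= gap r x rho 0 l k2 0.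
  rewrite /gap x2E (_ : r - k2 = (r - k2).-1.+1)%N; last by lia.
  by rewrite Psi_b0_at0// subr_ge0.
apply: (@one_knot_comparison _ (- rho) (gap r x rho 0 l) r.-1 _ _ k2 k3) => //.
- by move=> k t kr tr; apply: gap_rderiv.
- by move=> k kr; apply: gap_left => //; lia.
- by lia.
- exact: gap_no_pos_after_neg.
- rewrite /gap x3E; move: rhoE f0; rewrite (_ : r - k3 = (r - k3).-1.+1)%N; last by lia.
  move=> rhoE f0; rewrite Psi_b0_at0// rhoE.
  by field; rewrite f0 gt_eqF.
- by rewrite lexx oppr_le0 ltW.
Qed.

Lemma zeroth_norm_ge (a b : R) : 0 <= b < a -> Psi (r - k2) a b l 0 = M2 ->
  Psi (r - k3) a b l 0 = M3 -> Psi r a b l 0 <= derivk 0 x 0.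
Proof.
move=> ab P2 P3; rewrite -subr_ge0 -[X in Psi X](subn0 r).
apply: (@two_knot_comparison _ (- a) (gap r x a b l) r.-1 _ _ _ k2 k3) => //.
- by have /andP[b0 ba] := ab; rewrite oppr_le0 (le_trans b0)// ltW.
- by move=> k t kr tr; apply: gap_rderiv.
- by move=> k kr; apply: gap_left => //; lia.
- by lia.
- exact: gap_no_pos_between_neg.
- by rewrite /gap x3E P3 subrr.
- by rewrite /gap x2E P2 subrr.
Qed.

End lower_bounds.

Lemma Phi_params_ex {R : realType} (r k2 k3 : nat) (M2 M3 l rho : R) :
  (k2 < k3)%N -> (k3.+1 < r)%N -> 0 < M3 -> 0 < l -> 0 < rho ->
  rho ^+ (r - k3) = (r - k3)`!%:R * M3 / l ->
  l / (r - k2)`!%:R * rho ^+ (r - k2) <= M2 ->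
  exists p, Phi_params r k2 k3 M2 M3 l p.
Proof.
move=> k23 k3r M30 l0 rho0 rhoE M2ge.
have f0 n : 0 < n`!%:R :> R by rewrite ltr0n fact_gt0.
have B30 : 0 < (r - k3)`!%:R * M3 / l by rewrite divr_gt0// mulr_gt0.
have B2 : rho ^+ (r - k2) <= (r - k2)`!%:R * M2 / l.
  rewrite ler_pdivlMr//; move: M2ge; rewrite -(ler_pM2l (f0 (r - k2)%N)).
  by apply: le_trans; rewrite mulrA mulrCA mulfV ?gt_eqF// mulr1 mulrC.
have [||a [b [ab E3 E2]]] := @hat_ex _ (r - k3) (r - k2) _ _ rho _ _ B30 rho0 rhoE B2.
- by lia.
- by lia.
exists (a, b, l); apply/Phi_paramsP => //; split => //.
- by rewrite Psi_at0// E2; field; rewrite !gt_eqF.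
- by rewrite Psi_at0// E3; field; rewrite !gt_eqF.
Qed.

Theorem theorem1 (R : realType) (r k1 k2 k3 k4 : nat) (M1 M2 M3 M4 : R)
    (hk1 : k1 = 0%N) (hk12 : (k1 < k2)%N) (hk23 : (k2 < k3)%N)
    (hk3 : (k3 + 2 <= r)%N) (hk4 : k4 = r)
    (hM1 : 0 < M1) (hM2 : 0 < M2) (hM3 : 0 < M3) (hM4 : 0 < M4) :
  (exists x : R -> R,
     Lrm_infinf r r.-1 x /\
     [/\ linf_norm (derivk k1 x) = M1%:E, linf_norm (derivk k2 x) = M2%:E,
         linf_norm (derivk k3 x) = M3%:E & linf_norm (derivk k4 x) = M4%:E])
  <->
  (M2 >= ((r - k3)`!%:R `^ ((r - k2)%:R / (r - k3)%:R)) / (r - k2)`!%:R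
         * M3 `^ ((r - k2)%:R / (r - k3)%:R)
         * M4 `^ ((k2%:R - k3%:R) / (r - k3)%:R)
   /\ (linf_norm (Phi r k2 k3 M2 M3 M4) <= M1%:E)%E).
Proof.
rewrite {k1}hk1 {k4}hk4 in hk12 *; rewrite addn2 in hk3.
have r1 : (1 < r)%N by lia.
have [||rho rho0 rhoE] := @nth_root_ex _ (r - k3) ((r - k3)`!%:R * M3 / M4).
- by rewrite subn_gt0; lia.
- by rewrite divr_gt0// mulr_gt0// ltr0n fact_gt0.
rewrite (bound_via_root hk23 _ hM3 hM4 rho0 rhoE); last by lia.
have normPhi : M4 / (r - k2)`!%:R * rho ^+ (r - k2) <= M2 ->
    exists a b : R, [/\ 0 <= b < a, Psi (r - k2) a b M4 0 = M2,
      Psi (r - k3) a b M4 0 = M3 &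
      linf_norm (Phi r k2 k3 M2 M3 M4) = (Psi r a b M4 0)%:E].
  move=> A; have := getPex (Phi_params_ex hk23 hk3 hM3 hM4 rho0 rhoE A).
  rewrite /Phi; case: (get _) => -[a b] l /Phi_paramsP[]// _ -> ab E2 E3.
  exists a, b; split => //.
  by have := @linf_norm_derivk_phi _ r 0 a b _ hM4 ab r1; rewrite subn0.
split.
- move=> [x [xL [x1 x2 x3 x4]]].
  have A := middle_norm_ge hk12 hk23 hk3 xL hM4 x2 x3 x4 rho0 rhoE.
  split => //; have [a [b [ab E2 E3 ->]]] := normPhi A.
  rewrite -x1 (linf_norm_derivk_member xL)// lee_fin.
  exact: (zeroth_norm_ge hk12 hk23 hk3 xL hM4 x2 x3 x4).
- move=> [A]; have [a [b [ab E2 E3 ->]]] := normPhi A; rewrite lee_fin => B.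
  have C0 : 0 <= M1 - Psi r a b M4 0 by rewrite subr_ge0.
  have /andP[b0 ba] := ab.
  exists (fun t => Psi r a b M4 t + (M1 - Psi r a b M4 0)); split.
    exact: Psi_Lrm.
  split; rewrite ?linf_norm_derivk_top ?linf_norm_derivk_Psi//; try by lia.
  + by rewrite subn0 mulr1n addrC subrK.
  + by rewrite E2 gtn_eqF// mulr0n addr0.
  + by rewrite E3 gtn_eqF ?(ltn_trans hk12)// mulr0n addr0.
Qed.
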